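(* Let $X$ be a Banach space of density $\omega_1$ with an unconditional basis. Then $X$ admits an overcomplete set if and only if $X$ is WLD.
   Context: All Banach spaces are infinite dimensional and over the reals. $dens(X)$ (the density) is the minimal cardinality of a norm dense subset of $X$. A subset $Y$ of a Banach space $X$ is called overcomplete (in $X$) if $|Y|=dens(X)$ and every $Z\subseteq Y$ with $|Z|=|Y|$ is linearly dense in $X$ (its linear span is norm dense in $X$). $X$ is WLD (weakly Lindelöf determined) if it admits a linearly dense set $D\subseteq X$ such that $\{d\in D: x^*(d)\neq 0\}$ is countable for each $x^*\in X^*$. An unconditional basis is a (possibly uncountable) family $(e_i)_{i\in I}$ in $X$ such that every $x\in X$ has a unique representation $x=\sum_{i\in I}a_ie_i$ with scalars $a_i$ and unconditional convergence. *)

(* Defs.v *)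
From HB Require Import structures.
From mathcomp Require Import all_boot all_order all_algebra.
From mathcomp Require Import finmap.
From mathcomp Require Import all_classical all_reals all_analysis.
From mathcomp.analysis.showcase Require summability.

Set Implicit Arguments.
Unset Strict Implicit.
Unset Printing Implicit Defensive.

Import Order.TTheory GRing.Theory Num.Theory.
Import numFieldNormedType.Exports.

Local Open Scope classical_set_scope.
Local Open Scope ring_scope.
Local Open Scope card_scope.

(* Cardinals are handled as sets up to the equipotence [#=]; [omega_1] is the
   least uncountable cardinal. *)
Definition card_omega1 (T : Type) (A : set T) : Prop :=
  ~ countable A /\ forall (U : Type) (B : set U), ~ countable B -> A #<= B.

(* |K| = dens(X), the least cardinality of a dense subset of X. *)
Definition is_density (X : topologicalType) (U : Type) (K : set U) : Prop :=
  (exists2 D : set X, dense D & D #= K) /\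
  (forall D : set X, dense D -> K #<= D).

Definition density_omega1 (X : topologicalType) : Prop :=
  exists2 K : set X, is_density X K & card_omega1 K.

Section BanachSpaces.
Variables (R : realType) (X : completeNormedModType R).

Definition linear_span (A : set X) : set X :=
  [set x | exists (n : nat) (c : 'I_n -> R) (v : 'I_n -> X),
     (forall i, A (v i)) /\ x = \sum_(i < n) c i *: v i].

Definition infinite_dimensional : Prop :=
  forall s : seq X, linear_span [set` s] <> [set: X].

Definition linearly_dense (A : set X) : Prop := dense (linear_span A).

Definition overcomplete (Y : set X) : Prop :=
  is_density X Y /\
  (forall Z : set X, Z `<=` Y -> Z #= Y -> linearly_dense Z).

(* The continuous linear forms f range over the dual space X^*. *)
Definition WLD : Prop :=
  exists2 D : set X, linearly_dense D &
    forall f : {linear X -> R^o}, continuous f ->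
      countable [set d | D d /\ f d <> 0].

(* Unconditional convergence is convergence of the net of the sums over the
   finite subsets of I directed by inclusion. *)
Definition unconditional_basis (I : choiceType) (e : I -> X) : Prop :=
  forall x : X, exists! a : I -> R,
    summability.partial_sum (fun i => a i *: e i) @ summability.totally --> x.

End BanachSpaces.

Arguments infinite_dimensional {R} X.
Arguments WLD {R} X.

(* Main.v *)
(** Suppose [Y] is overcomplete but some functional [f] is nonzero at uncountably
    many vectors [e i] of the basis.  Then [x |-> (a_i(x) f(e_i))_i] is a bounded
    operator into l_1(I), and a nonzero bounded weight [g] is built by
    exhaustion together with an uncountable subset of [Y] on which
    [x |-> \sum_i g_i a_i(x) f(e_i)] vanishes: outside a fixed finite set where [g]
    is 0, the part of [y] already weighted is dominated by its remaining part,
    so the next weights can be kept in [[-1, 1]].  Hence the basis is a WLD set.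

    Conversely, index a WLD set by [omega_1 x nat], and let
    [y_t = \sum_(x <= t, n) l_t ^ k * d_(x, n)] with [k] encoding
    [(psi_t x, n)], where the injections [psi_t] have only countably many
    restrictions to each initial segment (as in the construction of an Aronszajn
    tree) and the [l_t] are distinct.  A functional has countable support, so its
    values at uncountably many [y_t] are values of one and the same power series
    at infinitely many points; if all of them are 0, so is the functional. *)

Require Import Defs.
From HB Require Import structures.
From mathcomp Require Import all_boot all_order all_algebra.
From mathcomp Require Import finmap.
From mathcomp Require Import all_classical all_reals all_analysis.
From mathcomp Require Import ring lra.

Set Implicit Arguments.
Unset Strict Implicit.
Unset Printing Implicit Defensive.

Import Order.TTheory GRing.Theory Num.Theory.
Import numFieldNormedType.Exports.

Local Open Scope classical_set_scope.
Local Open Scope ring_scope.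

(** * Hahn-Banach *)

Section HahnBanach.
Variables (R : realType) (V : lmodType R).

Definition sublinear (p : V -> R) :=
  (forall x y, p (x + y) <= p x + p y) /\
  (forall a x, 0 <= a -> p (a *: x) = a * p x).

Lemma sublinear0 (p : V -> R) : sublinear p -> p 0 = 0.
Proof. by case=> _ /(_ 0 0 (lexx _)); rewrite scale0r mul0r. Qed.

Lemma sublinearN (p : V -> R) x : sublinear p -> - p (- x) <= p x.
Proof.
move=> sp; have := sp.1 x (- x); rewrite subrr sublinear0 // => ?.
by rewrite lerNl -subr_ge0 opprK addrC.
Qed.

Lemma sublinear_inf (S : V -> set R) :
  (forall x, has_inf (S x)) ->
  (forall x y a b, S x a -> S y b -> exists2 c, S (x + y) c & c <= a + b) ->
  (forall k x a, 0 < k -> S x a -> exists2 c, S (k *: x) c & c <= k * a) ->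
  inf (S 0) = 0 -> sublinear (fun x => inf (S x)).
Proof.
move=> Sinf SD SZ S0.
have infle x a : S x a -> inf (S x) <= a.
  by move=> Sa; apply: ge_inf => //; have [] := Sinf x.
split=> [x y|a x a0].
  rewrite -lerBlDr; apply: lb_le_inf => [|a Sa]; first by have [] := Sinf x.
  rewrite lerBlDr -lerBlDl; apply: lb_le_inf => [|b Sb].
    by have [] := Sinf y.
  by rewrite lerBlDl; have [c Sc] := SD _ _ _ _ Sa Sb; apply/le_trans/infle.
have half k z : 0 < k -> inf (S (k *: z)) <= k * inf (S z).
  move=> k0; rewrite -ler_pdivrMl //.
  apply: lb_le_inf => [|b Sb]; first by have [] := Sinf z.
  by rewrite ler_pdivrMl //; have [c Sc] := SZ _ _ _ k0 Sb; apply/le_trans/infle.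
have [->|an0] := eqVneq a 0; first by rewrite scale0r mul0r.
have {an0}a0 : 0 < a by rewrite lt_def an0.
apply/eqP; rewrite eq_le half //=.
have := half a^-1 (a *: x); rewrite invr_gt0 => /(_ a0).
by rewrite scalerA mulVf ?gt_eqF// scale1r mulrC ler_pdivlMr // mulrC.
Qed.

Lemma sublinear_shift (p : V -> R) (x0 : V) : sublinear p ->
  exists q : V -> R, [/\ sublinear q, forall x, q x <= p x &
    forall x, q x <= p (x + x0) - p x0].
Proof.
move=> sp.
pose S x : set R := [set p (x + t *: x0) - t * p x0 | t in [set t | 0 <= t]].
have lbS x : lbound (S x) (- p (- x)).
  move=> _ [t /= t0 <-]; rewrite -sp.2//.
  by have := sp.1 (x + t *: x0) (- x); rewrite addrAC subrr add0r; lra.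
have Sinf x : has_inf (S x).
  split; last by exists (- p (- x)).
  by exists (p (x + 0 *: x0) - 0 * p x0); exists 0 => //=.
have infle x a : S x a -> inf (S x) <= a.
  by move=> Sa; apply: ge_inf => //; have [] := Sinf x.
have qp x : inf (S x) <= p x.
  by apply: infle; exists 0 => //=; rewrite scale0r addr0 mul0r subr0.
exists (fun x => inf (S x)); split => // [|x].
  apply: sublinear_inf => //.
  - move=> x y _ _ [s /= s0 <-] [t /= t0 <-].
    exists (p (x + y + (s + t) *: x0) - (s + t) * p x0).
      by exists (s + t); rewrite /= ?addr_ge0.
    have := sp.1 (x + s *: x0) (y + t *: x0).
    by rewrite addrACA -scalerDl; lra.
  - move=> k x _ k0 [t /= t0 <-].
    exists (p (k *: x + (k * t) *: x0) - (k * t) * p x0).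
      by exists (k * t) => //=; rewrite mulr_ge0 // ltW.
    by rewrite -scalerA -scalerDr (sp.2 _ _ (ltW k0)) -mulrA -mulrBr.
  - apply/eqP; rewrite eq_le -{1}(sublinear0 sp) qp /=.
    apply: lb_le_inf; first by have [] := Sinf 0.
    by move=> a /lbS; rewrite oppr0 sublinear0 // oppr0.
by apply: infle; exists 1 => //=; rewrite scale1r mul1r.
Qed.

Lemma sublinear_minimal (p : V -> R) : sublinear p ->
  exists q : V -> R, [/\ sublinear q, forall x, q x <= p x &
    forall q', sublinear q' -> (forall x, q' x <= q x) -> q' = q].
Proof.
move=> sp.
pose T := {q : V -> R | sublinear q /\ forall x, q x <= p x}.
pose le_ (s t : T) := `[< forall x, sval t x <= sval s x >].
have := @Zorn T le_; case.
- by move=> t; apply/asboolP.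
- by move=> r s t /asboolP rs /asboolP st; apply/asboolP => x; apply: le_trans (rs x).
- move=> [s s'] [t t'] /asboolP /= rs /asboolP /= st; apply: eq_exist => /=.
  by apply/funext => x; apply/eqP; rewrite eq_le st rs.
- move=> A totA.
  have [[a0 Aa0]|nA] := pselect (A !=set0); last first.
    exists (exist _ p (conj sp (fun x => lexx _))) => s As.
    by exfalso; apply: nA; exists s.
  pose S x : set R := [set sval a x | a in A].
  have Sinf x : has_inf (S x).
    split; first by exists (sval a0 x); exists a0.
    exists (- p (- x)) => _ [[a [sa pa]] /= _ <-].
    by apply: le_trans (sublinearN _ sa); rewrite lerN2.
  have infle a x : A a -> inf (S x) <= sval a x.
    by move=> Aa; apply: ge_inf; [have [] := Sinf x | exists a].
  have sq : sublinear (fun x => inf (S x)).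
    apply: sublinear_inf => //.
    + move=> x y _ _ [a Aa <-] [b Ab <-].
      have [/asboolP ab|/asboolP ba] := totA _ _ Aa Ab.
        exists (sval b (x + y)); first by exists b.
        apply: le_trans ((svalP b).1.1 _ _) _.
        by rewrite lerD2r.
      exists (sval a (x + y)); first by exists a.
      apply: le_trans ((svalP a).1.1 _ _) _.
      by rewrite lerD2l.
    + move=> k x _ k0 [a Aa <-]; exists (sval a (k *: x)); first by exists a.
      by rewrite (svalP a).1.2 // ltW.
    + suff -> : S 0 = [set 0] by rewrite inf1.
      apply/seteqP; split=> [_ [a _ <-] /=|_ ->]; first exact: sublinear0 (svalP a).1.
      by exists a0 => //; exact: sublinear0 (svalP a0).1.
  have sqp x : inf (S x) <= p x by apply: le_trans (infle _ _ Aa0) ((svalP a0).2 x).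
  pose t : T := exist _ (fun x => inf (S x)) (conj sq sqp).
  exists t => s As; apply/asboolP => x /=; exact: infle.
move=> [q [sq qp]] /= minq; exists q; split => // q' sq' q'q.
have q'p x : q' x <= p x by exact: le_trans (q'q x) (qp x).
by have /(_ _)/(congr1 sval) := minq (exist _ q' (conj sq' q'p)); apply; apply/asboolP.
Qed.

(* A minimal sublinear functional is linear: it coincides with each of its
   directional minorants [sublinear_shift]. *)
Theorem hahn_banach (p : V -> R) (x0 : V) : sublinear p ->
  exists f : {linear V -> R^o}, (forall x, f x <= p x) /\ f x0 = p x0.
Proof.
move=> sp; have [p' [sp' p'p p'x0]] := sublinear_shift x0 sp.
have [q [sq qp' minq]] := sublinear_minimal sp'.
have qD x y : q (x + y) = q x + q y.
  apply/eqP; rewrite eq_le sq.1 /=.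
  have [q' [sq' q'q q'y]] := sublinear_shift y sq.
  by have := q'y x; rewrite (minq _ sq' q'q); lra.
have qN x : q (- x) = - q x.
  by have := qD x (- x); rewrite subrr sublinear0 //; lra.
have ql : linear (q : V -> R^o).
  move=> a x y; rewrite qD; congr (_ + _).
  have [a0|/ltW a0] := leP 0 a; first by rewrite sq.2.
  by rewrite -[a *: x]opprK -scaleNr qN sq.2 ?oppr_ge0 // mulNr opprK.
pose f : {linear V -> R^o} := HB.pack (q : V -> R^o)
  (GRing.isLinear.Build R V R^o _ q ql).
exists f; split=> [x|]; first exact: le_trans (qp' x) (p'p x).
apply/eqP; rewrite eq_le (le_trans (qp' _) (p'p _)) /=.
have := p'x0 (- x0); have := qp' (- x0).
by rewrite addNr sublinear0 // qN; lra.
Qed.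

End HahnBanach.

Section Separation.
Variables (R : realType) (X : completeNormedModType R).
Implicit Types A : set X.

Lemma linear_span_sub A : A `<=` linear_span A.
Proof.
move=> x Ax; exists 1, (fun=> 1), (fun=> x); split => //.
by rewrite big_ord1 scale1r.
Qed.

Lemma linear_span0 A : linear_span A 0.
Proof.
by exists 0, (fun=> 0), (fun=> 0); split; [case|rewrite big_ord0].
Qed.

Lemma linear_spanZ A a x : linear_span A x -> linear_span A (a *: x).
Proof.
move=> [n [c [v [Av ->]]]]; exists n, (fun i => a * c i), v; split => //.
by rewrite scaler_sumr; apply: eq_bigr => i _; rewrite scalerA.
Qed.

Lemma linear_spanD A x y :
  linear_span A x -> linear_span A y -> linear_span A (x + y).
Proof.
move=> [n [c [v [Av ->]]]] [m [d [w [Aw ->]]]].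
exists (n + m)%N,
  (fun i : 'I_(n + m) =>
     match fintype.split i with inl j => c j | inr j => d j end),
  (fun i : 'I_(n + m) =>
     match fintype.split i with inl j => v j | inr j => w j end); split.
  by move=> i; case: (fintype.split i) => j.
rewrite big_split_ord /=; congr (_ + _); apply: eq_bigr => i _.
  by rewrite (unsplitK (inl i)).
by rewrite (unsplitK (inr i)).
Qed.

Lemma continuous_form (f : {linear X -> R^o}) C :
  (forall x, `|f x| <= C * `|x|) -> continuous f.
Proof.
move=> fC; apply/linear_bounded_continuous/linear_boundedP.
exists C; split=> [|M CM x]; first exact: num_real.
by apply: le_trans (fC x) _; rewrite ler_wpM2r // ltW.
Qed.

Lemma form_eq0_dense A (f : {linear X -> R^o}) : linearly_dense A ->
  continuous f -> (forall x, A x -> f x = 0) -> forall x, f x = 0.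
Proof.
move=> dA cf fA x; apply/eqP; apply: contrapT => /negP fx0.
have oU : open (f @^-1` [set t : R^o | t != 0]).
  by apply: open_comp => [y _|]; [exact: cf|exact: open_neq].
have [|y [/= fy [n [c [v [Av yE]]]]]] := dA _ _ oU; first by exists x.
move: fy; rewrite yE linear_sum big1 ?eqxx // => i _.
by rewrite linearZ /= fA // scaler0.
Qed.

Lemma not_linearly_dense_form A : ~ linearly_dense A ->
  exists f : {linear X -> R^o}, [/\ continuous f,
    forall x, A x -> f x = 0 & exists x, f x <> 0].
Proof.
move=> /existsNP [U /not_implyP [[x0 Ox0] /not_implyP [oO OA]]].
have [r r0 rO] : exists2 r, 0 < r & ball x0 r `<=` U.
  by have /nbhs_ballP[r /= r0 rO] := open_nbhs_nbhs (conj oO Ox0); exists r.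
have far y : linear_span A y -> r <= `|x0 - y|.
  move=> Ay; rewrite leNgt; apply/negP => xy; apply: OA; exists y; split => //.
  by apply: rO; rewrite -ball_normE.
pose S x : set R := [set `|x - y| | y in linear_span A].
have Sinf x : has_inf (S x).
  split; first by exists `|x - 0|; exists 0 => //; exact: linear_span0.
  by exists 0 => _ [y _ <-].
have infle x y : linear_span A y -> inf (S x) <= `|x - y|.
  by move=> Sa; apply: ge_inf; [have [] := Sinf x|exists y].
have inf0 x : linear_span A x -> inf (S x) = 0.
  move=> Ax; apply/eqP; rewrite eq_le (le_trans (infle _ _ Ax)) ?subrr ?normr0//=.
  by apply: lb_le_inf => [|_ [y _ <-]] //; have [] := Sinf x.
have sp : sublinear (fun x => inf (S x)).
  apply: sublinear_inf => //.
  - move=> x y _ _ [a Aa <-] [b Ab <-]; exists `|(x + y) - (a + b)|.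
      by exists (a + b) => //; exact: linear_spanD.
    by rewrite opprD addrACA ler_normD.
  - move=> k x _ k0 [a Aa <-]; exists `|k *: x - k *: a|.
      by exists (k *: a) => //; exact: linear_spanZ.
    by rewrite -scalerBr normrZ gtr0_norm.
  - by apply: inf0; exact: linear_span0.
have [f [fp fx0]] := hahn_banach x0 sp.
have fle x : f x <= `|x|.
  by apply: le_trans (fp x) _; rewrite -{2}(subr0 x); apply: infle; exact: linear_span0.
exists f; split.
- apply: (@continuous_form _ 1) => x; rewrite mul1r ler_norml fle andbT.
  by have := fle (- x); rewrite linearN normrN /= => ?; rewrite lerNl.
- move=> x /linear_span_sub Ax; apply/eqP; rewrite eq_le -{1}(inf0 _ Ax) fp /=.
  rewrite -oppr_le0; have := fp (- x); rewrite linearN inf0 //.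
  by rewrite -scaleN1r; exact: linear_spanZ.
- exists x0; rewrite fx0; apply/eqP; rewrite gt_eqF //.
  apply: lt_le_trans r0 _; apply: lb_le_inf; first by have [] := Sinf x0.
  by move=> _ [y Ay <-]; exact: far.
Qed.

End Separation.

(** * Zeros of power series *)

Section PowerSeriesZeros.
Variable R : realType.
Implicit Types (h : nat -> R) (l p H : R).

Definition power_sum h l (n : nat) : R := \sum_(i < n) h i * l ^+ i.

Definition power_zero h l := power_sum h l @ \oo --> (0 : R).

Lemma power_sumS h l n : power_sum h l n.+1 = power_sum h l n + h n * l ^+ n.
Proof. by rewrite /power_sum big_ord_recr. Qed.

Definition power_quot h p (m : nat) : R := - power_sum h p m.+1 / p ^+ m.+1.

Lemma power_quot_bound h p H : 0 < p <= 3^-1 -> (forall n, `|h n| <= H) ->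
  power_zero h p -> forall m, `|power_quot h p m| <= 3 / 2 * H.
Proof.
move=> /andP[p0 p3] hH hp m.
have H0 : 0 <= H by exact: le_trans (hH 0).
have le1 N : `|power_sum h p (m.+1 + N)%N - power_sum h p m.+1| <=
    3 / 2 * H * (p ^+ m.+1 - p ^+ (m.+1 + N)).
  elim: N => [|N IH]; first by rewrite addn0 !subrr normr0 mulr0.
  rewrite addnS power_sumS addrAC; apply: le_trans (ler_normD _ _) _.
  apply: le_trans (lerD IH _) _; first exact: lexx.
  rewrite normrM normrX (gtr0_norm p0).
  have q0 : 0 <= p ^+ (m.+1 + N) by rewrite exprn_ge0 // ltW.
  have : `|h (m.+1 + N)%N| * p ^+ (m.+1 + N) <= H * p ^+ (m.+1 + N).
    by rewrite ler_wpM2r.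
  rewrite [p ^+ (m.+1 + N).+1]exprS.
  have : 0 <= H * p ^+ (m.+1 + N) * (3^-1 - p) by rewrite !mulr_ge0 // subr_ge0.
  set r := p ^+ (m.+1 + N); set t := `|h _|; lra.
have le2 N : `|power_sum h p m.+1| <=
    3 / 2 * H * p ^+ m.+1 + `|power_sum h p (m.+1 + N)%N|.
  have := le1 N; rewrite distrC => le1N.
  have := ler_normD (power_sum h p m.+1 - power_sum h p (m.+1 + N)%N)
    (power_sum h p (m.+1 + N)%N).
  rewrite subrK => /le_trans; apply; rewrite lerD2r (le_trans le1N) //.
  have : 0 <= 3 / 2 * H * p ^+ (m.+1 + N).
    by rewrite !mulr_ge0 // exprn_ge0 // ltW.
  lra.
have pm0 : 0 < p ^+ m.+1 by rewrite exprn_gt0.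
rewrite /power_quot normrM normrN normfV (gtr0_norm pm0) ler_pdivrMr //.
apply/ler_addgt0Pr => e e0.
have [N _ /(_ (m.+1 + N)%N (leq_addl _ _)) /=] := cvgr0_norm_lt _ hp _ e0.
by move=> small; apply: le_trans (le2 N) _; rewrite lerD2l ltW.
Qed.

Lemma power_quotP h p l n : p != 0 ->
  (l - p) * power_sum (power_quot h p) l n.+1 =
  power_sum h l n.+1 + power_quot h p n * l ^+ n.+1.
Proof.
move=> p0; elim: n => [|n IH].
  by rewrite /power_quot /power_sum !big_ord_recr !big_ord0 /=; field.
rewrite power_sumS mulrDr IH [power_sum h l n.+2]power_sumS.
have -> : h n.+1 = power_quot h p n - p * power_quot h p n.+1.
  rewrite /power_quot [power_sum h p n.+2]power_sumS [p ^+ n.+2]exprS.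
  have : p ^+ n.+1 != 0 by rewrite expf_neq0.
  set q := p ^+ _ => q0; field; rewrite ?p0 ?q0 //.
by rewrite [l ^+ n.+2]exprS; ring.
Qed.

Lemma power_zero_quot h p l H : 0 < p <= 3^-1 -> 0 < l <= 3^-1 -> l != p ->
  (forall n, `|h n| <= H) ->
  power_zero h p -> power_zero h l -> power_zero (power_quot h p) l.
Proof.
move=> pI lI lp hH hp hl; have gH := power_quot_bound pI hH hp.
have [/andP[p0 p3] /andP[l0 l3]] := (pI, lI).
have lp0 : l - p != 0 by rewrite subr_eq0.
rewrite /power_zero -cvg_shiftS.
have -> : (fun n => power_sum (power_quot h p) l n.+1) =
    (fun n => (l - p)^-1 * (power_sum h l n.+1 + power_quot h p n * l ^+ n.+1)).
  by apply/funext => n; rewrite -power_quotP ?gt_eqF// mulKf.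
set F := fun n => _; suff : F @ \oo --> (l - p)^-1 * (0 + 0).
  by rewrite addr0 mulr0.
apply: cvgMl_tmp; apply: cvgD.
  by move: hl; rewrite /power_zero -cvg_shiftS.
have l1 : `|l| < 1 by rewrite gtr0_norm //; lra.
have /cvgrPdist_lt cl := cvg_expr l1.
apply/cvgrPdist_lt => e e0.
have M0 : 0 < 3 / 2 * H + 1.
  by have := le_trans (normr_ge0 _) (gH 0%N); lra.
near=> n; rewrite sub0r normrN normrM.
apply: le_lt_trans (_ : (3 / 2 * H + 1) * `|l ^+ n.+1| < e).
  by rewrite ler_wpM2r // (le_trans (gH n)) // lerDl.
rewrite -ltr_pdivlMl // exprS normrM.
apply: le_lt_trans (_ : `|l ^+ n| < _).
  by rewrite ler_piMl // ltW.
rewrite -[l ^+ n]subr0 distrC; near: n; apply: cl.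
by rewrite mulr_gt0 ?invr_gt0.
Unshelve. all: by end_near. Qed.

(* Jensen-type estimate: dividing by the factors [X - p], [p] in the list,
   multiplies the bound on the coefficients by at most 3/2 each time, while the
   constant term is the product of the roots and that of the quotient. *)
Lemma power_zeros_head (s : seq R) h H : uniq s -> (forall n, `|h n| <= H) ->
  (forall l, l \in s -> 0 < l <= 3^-1 /\ power_zero h l) ->
  `|h 0%N| <= H / 2 ^+ size s.
Proof.
elim: s h H => [|p s IH] h H /=; first by rewrite expr0 divr1.
move=> /andP[ps us] hH sh.
have [pI hp] := sh p (mem_head _ _); have [/andP[p0 p3]] := (pI).
have IH' := IH (power_quot h p) (3 / 2 * H) us (power_quot_bound pI hH hp) _.
have -> : h 0%N = - (p * power_quot h p 0%N).
  rewrite /power_quot /power_sum big_ord_recr big_ord0 /= expr0 expr1.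
  by field; rewrite gt_eqF.
rewrite normrN normrM (gtr0_norm p0) exprS.
have {IH'} : `|power_quot h p 0| <= 3 / 2 * H / 2 ^+ size s.
  apply: IH' => l ls; have [lI hl] : 0 < l <= 3^-1 /\ power_zero h l.
    by apply: sh; rewrite inE ls orbT.
  split => //; apply: power_zero_quot hp hl => //.
  by apply: contraNneq ps => <-.
have q0 : 0 < (2 ^+ size s)^-1 :> R by rewrite invr_gt0 exprn_gt0.
rewrite invfM; move: q0; set q := _^-1 => q0; set t := `|_| => tq.
have t0 : 0 <= t by rewrite /t.
have : 0 <= (3^-1 - p) * t by rewrite mulr_ge0 // subr_ge0.
nra.
Qed.

Theorem power_series_zeros_eq0 h H (A : set R) : infinite_set A ->
  (forall n, `|h n| <= H) ->
  (forall l, A l -> 0 < l <= 3^-1 /\ power_zero h l) -> forall n, h n = 0.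
Proof.
move=> infA hH Ah n.
have head0 g : (forall n, `|g n| <= H) ->
    (forall l, A l -> 0 < l <= 3^-1 /\ power_zero g l) -> g 0%N = 0.
  move=> gH Ag; apply/eqP; rewrite -normr_le0; apply/ler_addgt0Pr => e e0.
  rewrite add0r.
  have [k _ /(_ k (leqnn _))] : \forall k \near \oo, `|H * 2^-1 ^+ k| < e.
    apply: cvgr0_norm_lt => //.
    suff : (fun k => H * 2^-1 ^+ k) @ \oo --> H * 0 by rewrite mulr0.
    apply: cvgMl_tmp.
    by apply: cvg_expr; rewrite gtr0_norm //; lra.
  move=> /= ke; have [B BA kB] := infinite_set_fset k infA.
  have /power_zeros_head/(_ gH) := fset_uniq B.
  have Bg l : l \in enum_fset B -> 0 < l <= 3^-1 /\ power_zero g l.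
    by move=> lB; apply/Ag/BA.
  move=> /(_ Bg) /le_trans; apply; apply: le_trans (ltW ke).
  have H0 : 0 <= H by exact: le_trans (gH 0).
  rewrite ger0_norm ?mulr_ge0 ?exprn_ge0 ?invr_ge0 // exprVn ler_wpM2l //.
  by rewrite lef_pV2 ?posrE ?exprn_gt0 // ler_weXn2l // ler1n.
elim: n h hH Ah => [|n IH] h hH Ah; first exact: head0.
apply: (IH (h \o S)) => [m|l Al]; first exact: hH.
have [lI hl] := Ah l Al; split => //.
have l0 : l != 0 by case/andP: lI => l0 _; rewrite gt_eqF.
rewrite /power_zero.
have -> : power_sum (h \o S) l = fun n => l^-1 * power_sum h l n.+1.
  apply/funext => k; rewrite /power_sum big_ord_recl head0 // mul0r add0r.
  by rewrite mulr_sumr; apply: eq_bigr => i _ /=; rewrite exprS mulrCA mulKf.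
suff : (fun n => l^-1 * power_sum h l n.+1) @ \oo --> l^-1 * 0.
  by rewrite mulr0.
apply: cvgMl_tmp.
by move: hl; rewrite /power_zero -cvg_shiftS.
Qed.

End PowerSeriesZeros.

(** * Coherent injections of countable ordinals *)

Record omega1_order (T : Type) (lt : T -> T -> Prop) : Prop := Omega1Order {
  o1_irr : forall x, ~ lt x x;
  o1_trans : forall x y z, lt x y -> lt y z -> lt x z;
  o1_total : forall x y, lt x y \/ x = y \/ lt y x;
  o1_wf : well_founded lt;
  o1_initial : forall t, countable [set x | lt x t];
  o1_uncountable : ~ countable [set: T] }.

Lemma sub_uncountable (T : Type) (A B : set T) :
  A `<=` B -> ~ countable A -> ~ countable B.
Proof. by move=> AB nA cB; apply: nA; apply: sub_countable cB; exact: subset_card_le. Qed.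

Lemma countableU (T : Type) (A B : set T) :
  countable A -> countable B -> countable (A `|` B).
Proof.
move=> cA cB; rewrite -bigcup2E; apply: bigcup_countable => // -[|[|n]] _ //=.
Qed.

Lemma uncountableD (T : Type) (A B : set T) :
  ~ countable A -> countable B -> ~ countable (A `\` B).
Proof.
move=> nA cB cD; apply: nA; apply: sub_countable (countableU cD cB).
by apply: subset_card_le => x Ax; have [Bx|nBx] := pselect (B x); [right|left].
Qed.

Lemma countable_image_inj (T U : Type) (A : set T) (f : T -> U) :
  {in A &, injective f} -> countable (f @` A) -> countable A.
Proof. by move=> /inj_card_eq /card_esym /eq_countable ->. Qed.

Lemma countable_image (T U : Type) (A : set T) (f : T -> U) :
  countable A -> countable (f @` A).
Proof. exact/sub_countable/card_image_le. Qed.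

Lemma uncountable_fiber (T U : Type) (A : set T) (C : set U) (f : T -> U) :
  ~ countable A -> countable C -> (forall t, A t -> C (f t)) ->
  exists2 c, C c & ~ countable [set t | A t /\ f t = c].
Proof.
move=> nA cC AC; apply: contrapT => nex; apply: nA.
apply: (@sub_countable _ _ _ (\bigcup_(c in C) [set t | A t /\ f t = c])).
  by apply: subset_card_le => t At; exists (f t) => //; exact: AC.
by apply: bigcup_countable => // c Cc; apply: contrapT => nc; apply: nex; exists c.
Qed.

Lemma omega1_order_exists (U : choiceType) (K : set U) : ~ countable K ->
  exists2 K0 : set U, K0 `<=` K & exists lt : K0 -> K0 -> Prop, omega1_order lt.
Proof.
move=> nK; have [R woR] := wochoice.well_ordering_principle U.
have minR (A : set U) : A !=set0 -> exists2 m, A m & forall x, A x -> R m x.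
  move=> [a Aa]; have [|m [[mA ml] _]] := woR [pred x | x \in A].
    by exists a; exact/mem_set.
  by exists m => [|x Ax]; [exact: set_mem mA|exact/ml/mem_set].
have Rtot x y : R x y \/ R y x.
  have [|m [->|->] mle] := minR [set x; y]; first by exists x; left.
    by left; apply: mle; right.
  by right; apply: mle; left.
have Ranti x y : R x y -> R y x -> x = y.
  move=> xy yx.
  have [|m [_ mu]] := woR [pred z | z \in [set x; y]].
    by exists x; apply/mem_set; left.
  have Rrefl z : R z z by case: (Rtot z z).
  transitivity m; [apply/esym|]; apply: mu; split;
    try by [apply/mem_set; left|apply/mem_set; right|move=> z /set_mem[->|->]].
have Rrefl z : R z z by case: (Rtot z z).
have Rtrans x y z : R x y -> R y z -> R x z.
  move=> xy yz.
  have [|m + mle] := minR [set w | w = x \/ w = y \/ w = z]; first by exists x; left.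
  have mx := mle x (or_introl erefl).
  have my := mle y (or_intror (or_introl erefl)).
  have mz := mle z (or_intror (or_intror erefl)).
  case=> [E|[E|E]]; rewrite E in mx my mz => //.
    by rewrite (Ranti _ _ xy mx).
  by rewrite -(Ranti _ _ yz my).
pose below t : set U := [set x | [/\ K x, R x t & x <> t]].
have [K0 [K0K nK0 K0i]] : exists K0 : set U, [/\ K0 `<=` K, ~ countable K0 &
    forall t, K0 t -> countable (K0 `&` below t)].
  have [bad|nbad] := pselect ([set t | K t /\ ~ countable (below t)] !=set0).
    have [t0 [Kt0 nt0] t0min] := minR _ bad.
    exists (below t0); split => // [x [] //|t [Kt tt0 tnt0]].
    apply: (@sub_countable _ _ _ (below t)); first by apply: subset_card_le => x [].
    by apply: contrapT => nt; apply: tnt0; apply: Ranti => //; apply: t0min.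
  exists K; split => // t Kt; apply: (@sub_countable _ _ _ (below t)).
    by apply: subset_card_le => x [].
  by apply: contrapT => nt; apply: nbad; exists t.
have valI : injective (set_val : K0 -> U) by exact: val_inj.
exists K0 => //; exists (fun x y => R (set_val x) (set_val y) /\ x <> y); split.
- by move=> x [].
- move=> x y z [xy nxy] [yz nyz]; split; first exact: Rtrans xy yz.
  by move=> xz; apply: nxy; apply: valI; apply: Ranti => //; rewrite xz.
- move=> x y; have [->|/eqP xy] := eqVneq x y; first by right; left.
  by case: (Rtot (set_val x) (set_val y)) => h; [left|right; right]; split => // /esym.
- move=> x; apply: contrapT => nx.
  pose lt (x y : K0) := R (set_val x) (set_val y) /\ x <> y.
  have [|_ [m nm <-] mle] := minR (set_val @` [set x | ~ Acc lt x]).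
    by exists (set_val x); exists x.
  apply: nm; split => y [ym nym]; apply: contrapT => ny.
  by apply: nym; apply: valI; apply: Ranti => //; apply: mle; exists y.
- move=> t; apply: (@countable_image_inj _ _ _ set_val).
    by move=> x y _ _; exact: valI.
  apply: sub_countable (K0i (set_val t) (set_valP t)); apply: subset_card_le.
  move=> _ [x [xt nxt] <-]; split; first exact: set_valP.
  by split => // [|/valI //]; apply: K0K; exact: set_valP.
- by rewrite (eq_countable (card_setT K0)).
Qed.

Section CoherentInjections.
Variables (T : choiceType) (lt : T -> T -> Prop).
Hypothesis lto : omega1_order lt.
Let le x y := lt x y \/ x = y.

Let lt_irr x : ~ lt x x. Proof. exact: o1_irr lto x. Qed.
Let lt_trans x y z : lt x y -> lt y z -> lt x z.
Proof. exact: o1_trans lto x y z. Qed.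
Let le_refl x : le x x. Proof. by right. Qed.
Let le_lt_trans x y z : le x y -> lt y z -> lt x z.
Proof. by case=> [|->] //; exact: lt_trans. Qed.
Let nlt_le x y : ~ lt x y -> le y x.
Proof.
move=> nxy; case: (o1_total lto x y) => [//|[->|yx]]; last by left.
exact: le_refl.
Qed.

Lemma countable_le t : countable [set x | le x t].
Proof.
exact: countableU (o1_initial lto t) (countable1 t).
Qed.

Lemma countable_bounded (A : set T) : countable A ->
  exists t, forall x, A x -> lt x t.
Proof.
move=> cA; apply: contrapT => nA; apply: (o1_uncountable lto).
apply: (@sub_countable _ _ _ (\bigcup_(x in A) [set y | le y x])).
  apply: subset_card_le => t _; apply: contrapT => nt; apply: nA; exists t.
  by move=> x Ax; apply: contrapT => /nlt_le tx; apply: nt; exists x.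
by apply: bigcup_countable => // x _; exact: countable_le.
Qed.

Let code_ex t : exists f : T -> nat, forall x y, lt x t -> lt y t -> f x = f y -> x = y.
Proof.
have /countable_injP[f finj] := o1_initial lto t.
by exists f => x y xt yt; apply: finj; apply/mem_set.
Qed.
Let code t := sval (cid (code_ex t)).
Let codeI t x y : lt x t -> lt y t -> code t x = code t y -> x = y.
Proof. exact: (svalP (cid (code_ex t))). Qed.

Let next_ex t x : exists y, lt x t ->
  [/\ le x y, lt y t & forall z, le x z -> lt z t -> (code t y <= code t z)%N].
Proof.
have [xt|] := pselect (lt x t); last by exists x.
pose P := [pred n | `[< exists2 y, le x y /\ lt y t & code t y = n >]].
have exP : exists n, P n by exists (code t x); apply/asboolP; exists x.
case: (ex_minnP exP) => n /asboolP[y [xy yt] <-] ymin.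
exists y => _; split => // z xz zt.
by apply: ymin; apply/asboolP; exists z.
Qed.
Let next t x := sval (cid (next_ex t x)).
Let nextP t x : lt x t -> [/\ le x (next t x), lt (next t x) t &
  forall z, le x z -> lt z t -> (code t (next t x) <= code t z)%N].
Proof. exact: (svalP (cid (next_ex t x))). Qed.

Let step x t (rec : forall s, lt s t -> nat) : nat :=
  match pselect (lt x t), pselect (lt (next t x) t) with
  | left _, left nt => maxn (rec _ nt) (code t (next t x))
  | _, _ => 0
  end.

(* The value at [x] is inherited from the least-coded [y] with [x <= y < t] and
   raised to the code of [y]: only finitely many [y] matter for a given bound on
   [rho t x], or for [x] below a given [s < t]. *)
Let rho t x : nat := Fix (o1_wf lto) (fun=> nat) (step x) t.

Let rhoE t x : lt x t ->
  rho t x = maxn (rho (next t x) x) (code t (next t x)).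
Proof.
move=> xt; rewrite {1}/rho Fix_eq; last first.
  move=> t' f g fg; rewrite /step; case: pselect => // _.
  by case: pselect => // ?; rewrite fg.
rewrite {1}/step; case: pselect => // _; case: pselect => // -[].
by have [] := nextP xt.
Qed.

Let code_finite t n : finite_set [set y | lt y t /\ (code t y <= n)%N].
Proof.
have := finite_II n.+1; apply: card_le_finite.
rewrite -(card_le_eql (inj_card_eq (f := code t) _)).
  by apply: subset_card_le => _ [y [yt yn] <-].
by move=> x y /set_mem[xt _] /set_mem[yt _]; exact: codeI.
Qed.

Let rho_finite t n : finite_set [set x | le x t /\ (rho t x <= n)%N].
Proof.
elim: (o1_wf lto t) n => {}t _ IH n.
apply: (@sub_finite_set _ _ ([set t] `|`
    \bigcup_(y in [set y | lt y t /\ (code t y <= n)%N])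
      [set x | le x y /\ (rho y x <= n)%N])).
  move=> x [[xt|->]]; last by left.
  rewrite rhoE // geq_max => /andP[xn cn]; right.
  by have [xy yt _] := nextP xt; exists (next t x).
rewrite finite_setU; split; first exact: finite_set1.
by apply: bigcup_finite => [|y [yt _]]; [exact: code_finite|exact: IH].
Qed.

Let rho_coherent t s : lt s t -> finite_set [set x | le x s /\ rho s x <> rho t x].
Proof.
elim: (o1_wf lto t) s => {}t _ IH s st.
have coh y z : lt y t -> lt z t ->
    finite_set [set x | [/\ le x y, le x z & rho y x <> rho z x]].
  move=> yt zt; have [yz|[->|zy]] := o1_total lto y z.
  - by apply: sub_finite_set (IH z zt y yz) => x [].
  - by apply: sub_finite_set (finite_set0 _) => x [].
  - by apply: sub_finite_set (IH y yt z zy) => x [xy xz ne]; split=> // /esym.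
apply: (@sub_finite_set _ _
    (\bigcup_(y in [set y | lt y t /\ (code t y <= code t s)%N])
      ([set x | [/\ le x s, le x y & rho s x <> rho y x]] `|`
       [set x | le x y /\ (rho y x <= code t y)%N]))).
  move=> x [xs nst]; have xt := le_lt_trans xs st.
  have [xy yt ymin] := nextP xt.
  exists (next t x); first by split => //; exact: ymin.
  have [small|big] := leqP (rho (next t x) x) (code t (next t x)).
    by right; split.
  left; split => // E; apply: nst; rewrite (rhoE xt) E.
  by rewrite (maxn_idPl (ltnW big)).
apply: bigcup_finite => [|y [yt _]]; first exact: code_finite.
by rewrite finite_setU; split; [exact: coh|exact: rho_finite].
Qed.

Let fiber t x : set T := [set z | lt z x /\ rho t z = rho t x].

Let fiber_finite t x : le x t -> finite_set (fiber t x).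
Proof.
move=> xt; apply: sub_finite_set (rho_finite t (rho t x)) => z [zx E].
by split; [left; case: xt => [|<-//]; exact: lt_trans|rewrite E].
Qed.

(* The rank within a fiber of [rho t] depends on [rho t] below [x] only. *)
Let psi t x : nat * nat := (rho t x, #|` fset_set (fiber t x)|).

Let psi_lt t x y : le y t -> lt x y -> psi t x <> psi t y.
Proof.
move=> yt xy [rxy]; have xt : le x t by left; case: yt => [|<-//]; exact: lt_trans.
have [fx fy] := (fiber_finite xt, fiber_finite yt).
suff : (x |` fset_set (fiber t x) `<=` fset_set (fiber t y))%fset.
  move=> /fsubset_leq_card; rewrite cardfsU1 in_fset_set //.
  by rewrite memNset => [|[/lt_irr]] // + E; rewrite E add1n ltnn.
apply/fsubsetP => z; rewrite in_fset1U !in_fset_set // => /orP[/eqP->|].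
  by apply/mem_set; split.
by move=> /set_mem[zx rzx]; apply/mem_set; split; [exact: lt_trans xy|rewrite rzx].
Qed.

(* The restriction of [rho t] to the elements up to [d] differs from [rho d] at
   finitely many points only, so there are countably many such restrictions. *)
Let rho_agree (A : set T) d : ~ countable A -> exists B : set T,
  [/\ B `<=` A, ~ countable B, forall t, B t -> lt d t &
    forall s t x, B s -> B t -> le x d -> rho s x = rho t x].
Proof.
move=> nA; pose A' := A `\` [set t | le t d].
have nA' : ~ countable A' by apply: uncountableD nA _; exact: countable_le.
have A'd t : A' t -> lt d t by case=> _; apply: contra_notP => /nlt_le.
pose D t : set (T * nat) := [set p | le p.1 d /\ rho d p.1 <> rho t p.1 /\ p.2 = rho t p.1].
have cD : countable [set E : set (T * nat) |
    E `<=` [set x | le x d] `*` [set: nat] /\ finite_set E].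
  apply: countable_finite_subset; apply: countableX; first exact: countable_le.
  exact: countableP.
have [|E _ nE] := uncountable_fiber (f := D) nA' cD.
  move=> t A't; split; first by move=> [x n] [/= xd _]; split.
  apply: (@sub_finite_set _ _ ((fun x => (x, rho t x)) @`
      [set x | le x d /\ rho d x <> rho t x])).
    by move=> [x n] [/= xd [nx ->]]; exists x.
  by apply: finite_image; apply: rho_coherent; exact: A'd.
exists [set t | A' t /\ D t = E]; split => // [t [[]//]|t [/A'd]//|].
move=> s t x [_ sE] [_ tE] xd.
have [sx|nsx] := pselect (rho d x = rho s x); last first.
  have : D s (x, rho s x) by split.
  by rewrite sE -tE => -[_ [_]].
have [tx|ntx] := pselect (rho d x = rho t x); first by rewrite -sx.
have : D t (x, rho t x) by split.
by rewrite tE -sE => -[_ [_ /= ->]].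
Qed.

Theorem coherent_injections : exists psi : T -> T -> nat,
  (forall t x y, (lt x t \/ x = t) -> (lt y t \/ y = t) ->
     psi t x = psi t y -> x = y) /\
  (forall (A : set T) d, ~ countable A -> exists B : set T,
    [/\ B `<=` A, ~ countable B, forall t, B t -> lt d t &
      forall s t x, B s -> B t -> lt x d -> psi s x = psi t x]).
Proof.
exists (fun t x => choice.pickle (psi t x)); split.
  move=> t x y xt yt /(pcan_inj choice.pickleK) E.
  have [xy|[//|yx]] := o1_total lto x y; first by case: (psi_lt yt xy).
  by case: (psi_lt xt yx).
move=> A d nA; have [B [BA nB Bd BE]] := rho_agree d nA.
exists B; split => // s t x Bs Bt xd; congr choice.pickle; congr pair.
  by apply: BE => //; left.
congr (#|` fset_set _|); apply/seteqP; split => z [zx E]; split => //.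
  by rewrite -(BE s t) // -?(BE s t x) //; left => //; exact: lt_trans xd.
by rewrite (BE s t) // ?(BE s t x) //; left => //; exact: lt_trans xd.
Qed.

End CoherentInjections.

(** * Overcomplete sets in WLD spaces *)

Section WLDOvercomplete.
Variables (R : realType) (X : completeNormedModType R).

Lemma uncountable_itv (a b : R) : a < b -> ~ countable [set` `]a, b[].
Proof.
move=> ab /countable_lebesgue_measure0; rewrite lebesgue_measure_itv /= lte_fin ab.
by move=> /eqP; rewrite -EFinD eqe subr_eq0 gt_eqF.
Qed.

Lemma countable_enum (A : set X) : countable A ->
  exists g : nat -> X, (forall n, A (g n) \/ g n = 0) /\
    forall x, A x -> exists n, g n = x.
Proof.
move=> /countable_injP[c cI].
exists (fun n => xget 0 [set x | A x /\ c x = n]); split=> [n|x Ax].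
  by case: xgetP => [x _ [Ax _]|_]; [left|right].
exists (c x); case: xgetP => [y _ [Ay cy]|/(_ x) []//].
by apply: cI cy; exact/mem_set.
Qed.

Definition series_vec (u : nat -> X) (l : R) (n : nat) : X :=
  \sum_(i < n) l ^+ i *: u i.

Lemma series_vec_cvg (u : nat -> X) l : (forall n, `|u n| <= 1) -> 0 < l <= 3^-1 ->
  cvg (series_vec u l @ \oo).
Proof.
move=> u1 /andP[l0 l3].
have -> : series_vec u l = series (fun i => l ^+ i *: u i).
  by apply/funext => n; rewrite /series_vec /series /= big_mkord.
apply: normed_cvg.
apply: (@series_le_cvg _ _ (geometric 1 l)) => [n|n|n|].
- by rewrite normr_ge0.
- by rewrite /geometric /= mul1r exprn_ge0 // ltW.
- rewrite /= normrZ normrX (gtr0_norm l0) mul1r ler_piMr // exprn_ge0 //.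
  exact: ltW.
- by apply: is_cvg_geometric_series; rewrite gtr0_norm //; lra.
Qed.

Lemma form_series_vec (f : {linear X -> R^o}) u l : continuous f ->
  cvg (series_vec u l @ \oo) -> f (lim (series_vec u l @ \oo)) = 0 ->
  power_zero (f \o u) l.
Proof.
move=> cf cu f0; rewrite /power_zero.
have -> : power_sum (f \o u) l = f \o series_vec u l.
  apply/funext => n; rewrite /power_sum /series_vec /= linear_sum.
  by apply: eq_bigr => i _; rewrite linearZ /= mulrC.
by rewrite -f0; apply: continuous_cvg => //; exact: cf.
Qed.

Lemma span_dense_countable (D : set X) : linearly_dense D -> forall x : X,
  exists A : set X, [/\ A `<=` D, countable A &
    forall e, 0 < e -> exists2 w, linear_span A w & `|x - w| < e].
Proof.
move=> dD x.
have near_ n : exists w, linear_span D w /\ `|x - w| < n.+1%:R^-1.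
  have [||w [+ Dw]] := dD (ball x n.+1%:R^-1).
  - by exists x; exact: ballxx.
  - exact: ball_open.
  by rewrite -ball_normE => xw; exists w.
have vec_ n : exists B : set X, [/\ B `<=` D, countable B &
    exists2 w, linear_span B w & `|x - w| < n.+1%:R^-1].
  have [w [[k [c [v [Dv wE]]]] xw]] := near_ n.
  exists (range v); split => [_ [i _ <-] //||].
    by apply: countable_image; exact: countableP.
  by exists w => //; exists k, c, v; split => // i; exists i.
have [B BP] := choice vec_.
exists (\bigcup_n B n); split.
- by move=> y [n _]; have [+ _ _] := BP n; exact.
- by apply: bigcup_countable => [|n _]; [exact: countableP|have [] := BP n].
move=> e e0; have [n ne] := ltr_add_invr (y := 0) (x := e) e0.
have [_ _ [w [k [c [v [Bv ->]]]] xw]] := BP n.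
exists (\sum_(i < k) c i *: v i).
  by exists k, c, v; split => // i; exists n.
by apply: lt_trans xw _; rewrite add0r in ne.
Qed.

Lemma linearly_dense1_separable (c : X) : linearly_dense [set c] ->
  exists2 Q : set X, countable Q & dense Q.
Proof.
move=> dc; exists ((fun q : rat => ratr q *: c) @` setT).
  by apply: countable_image; exact: countableP.
move=> O O0 oO; have [x [Ox [n [a [v [vc xE]]]]]] := dc _ O0 oO.
pose b := \sum_(i < n) a i.
have xb : x = b *: c by rewrite xE scaler_suml; apply: eq_bigr => i _; rewrite vc.
have oP : open ((fun t : R => t *: c) @^-1` O).
  by apply: open_comp => // t _; exact: (@scalel_continuous R X).
have [|z [Oz [q _ qE]]] := dense_rat _ oP.
  by exists b; rewrite /= -xb.
by exists (ratr q *: c); split; [rewrite qE|exists q].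
Qed.

(* [d] lists the vectors of a WLD set, normalized; each vector is kept only at
   its first index in [K0], which makes the supports of functionals countable. *)
Lemma WLD_indexing (K0 : choiceType) (lt : K0 -> K0 -> Prop) (q : K0 -> X) :
  omega1_order lt -> dense (range q) -> WLD X ->
  exists d : K0 -> nat -> X, [/\ forall x n, `|d x n| <= 1,
    forall f : {linear X -> R^o}, continuous f ->
      countable [set x | exists n, f (d x n) <> 0] &
    forall f : {linear X -> R^o}, continuous f ->
      (forall x n, f (d x n) = 0) -> forall x, f x = 0].
Proof.
move=> lto dq [D dD Dctbl].
have [A AP] := choice (fun t => span_dense_countable dD (q t)).
pose A' t := A t `\` \bigcup_(s in [set s | lt s t]) A s.
have A'A t : A' t `<=` A t by move=> x [].
have cA' t : countable (A' t).
  by apply: sub_countable (subset_card_le (@A'A t)) _; have [] := AP t.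
have [g gP] := choice (fun t => countable_enum (cA' t)).
pose scal (x : X) : R := (1 + `|x|)^-1.
have scal0 x : 0 < scal x by rewrite invr_gt0 ltr_wpDr.
exists (fun t n => scal (g t n) *: g t n); split.
- move=> t n; rewrite normrZ gtr0_norm // /scal mulrC ler_pdivrMr ?ltr_wpDr //.
  by rewrite mul1r lerDr.
- move=> f cf; set S := [set x | _].
  have pick_ t : exists x, S t -> A' t x /\ f x <> 0.
    have [[n fn]|] := pselect (S t); last by exists 0.
    exists (g t n) => _.
    have fgn : f (g t n) <> 0.
      by move=> f0; apply: fn; rewrite linearZ /= f0 scaler0.
    split=> //; have [/(_ n)[//|g0] _] := gP t.
    by exfalso; apply: fgn; rewrite g0 linear0.
  have [w wP] := choice pick_.
  apply: (@countable_image_inj _ _ _ w).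
    move=> s t /set_mem Ss /set_mem St wst.
    have [[As nAs] _] := wP s Ss; have [[At nAt] _] := wP t St.
    have [st|[//|ts]] := o1_total lto s t.
      by exfalso; apply: nAt; exists s => //; rewrite -wst.
    by exfalso; apply: nAs; exists t => //; rewrite wst.
  apply: sub_countable (Dctbl f cf); apply: subset_card_le => _ [t St <-].
  have [/A'A At fw] := wP t St; split => //.
  by have [+ _ _] := AP t; exact.
- move=> f cf f0.
  have fA t x : A t x -> f x = 0.
    elim: (o1_wf lto t) => {}t _ IH Ax.
    have [[s st As]|nA] := pselect ((\bigcup_(s in [set s | lt s t]) A s) x).
      exact: IH As.
    have [_ /(_ x)[//|n <-]] := gP t.
    have /eqP := f0 t n; rewrite linearZ /= scaler_eq0 gt_eqF //= => /eqP.
    exact.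
  apply: (@form_eq0_dense _ _ (\bigcup_t A t)) => //; last first.
    by move=> x [t _]; exact: fA.
  move=> O O0 oO; have [z [Oz [t _ qE]]] := dq _ O0 oO.
  have /nbhs_ballP[e /= e0 eO] := open_nbhs_nbhs (conj oO Oz).
  have [_ _ /(_ e e0)[w Aw qw]] := AP t.
  exists w; split; first by apply: eO; rewrite -ball_normE /= -qE.
  have [k [c [v [Av ->]]]] := Aw.
  by exists k, c, v; split => // i; exists t.
Qed.

Lemma wld_overcomplete : density_omega1 X -> WLD X ->
  exists Y : set X, overcomplete Y.
Proof.
move=> [K [[Q dQ QK] Kmin] [nK Kle]] wld.
have [K0 K0K [lt lto]] := omega1_order_exists nK.
have K0E : ([set: K0] #= K0)%card := card_setT K0.
have nT := o1_uncountable lto.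
have nK0 : ~ countable K0 by rewrite -(eq_countable K0E).
have [q qs] : exists q : K0 -> X, set_surj [set: K0] Q q.
  apply/pcard_surjP; rewrite (card_le_eqr K0E) (card_le_eql QK); exact: Kle.
have dq : dense (range q).
  move=> O O0 oO; have [x [Ox /qs[t _ qt]]] := dQ _ O0 oO.
  by exists x; split => //; exists t.
have [d [d1 dsupp dtot]] := WLD_indexing lto dq wld.
have [psi [psiI psiC]] := coherent_injections lto.
have [lam lamP] : exists lam : K0 -> R, injective lam /\
    forall t, 0 < lam t <= 3^-1.
  have : ([set: K0] #<= [set` `]0 : R, 3^-1[])%card.
    rewrite (card_le_eql K0E) (card_le_trans (subset_card_le K0K)) // Kle //.
    by apply: uncountable_itv.
  move=> /pcard_leP[f]; exists f; split=> [s t|t].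
    by apply: inj; rewrite inE.
  have := @funS _ _ _ _ f t I; rewrite /= in_itv /= => /andP[-> /ltW].
  exact.
case: lamP => lamI lamP.
pose u t k : X := if pselect (exists p : K0 * nat,
    [/\ lt p.1 t \/ p.1 = t & choice.pickle (psi t p.1, p.2) = k]) is left ex
  then d (sval (cid ex)).1 (sval (cid ex)).2 else 0.
have uE t x n : lt x t \/ x = t -> u t (choice.pickle (psi t x, n)) = d x n.
  move=> xt; rewrite /u; case: pselect => [ex|[]]; last by exists (x, n).
  case: cid => -[y m] [/= yt /(pcan_inj choice.pickleK)[pE ->]].
  by rewrite (psiI _ _ _ yt xt pE).
have u0 t k : u t k <> 0 -> exists x n, [/\ lt x t \/ x = t,
    k = choice.pickle (psi t x, n) & u t k = d x n].
  rewrite /u; case: pselect => // ex _.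
  by case: cid => -[x n] /= [xt kE]; exists x, n.
have u1 t k : `|u t k| <= 1.
  by rewrite /u; case: pselect => [ex|_]; rewrite ?normr0.
pose y t : X := lim (series_vec (u t) (lam t) @ \oo).
have key (A : set K0) (f : {linear X -> R^o}) : continuous f -> ~ countable A ->
    (forall t, A t -> f (y t) = 0) -> forall x, f x = 0.
  move=> cf nA fA; apply: dtot => // x n.
  have [del delP] := countable_bounded lto (dsupp f cf).
  have [B [BA nB Bd BE]] := psiC A del nA.
  have hE s t k : B s -> B t -> f (u t k) <> 0 -> f (u s k) = f (u t k).
    move=> Bs Bt fu0; have : u t k <> 0.
      by move=> E; apply: fu0; rewrite E linear0.
    move=> /u0[x' [m [x't kE uk]]]; rewrite uk in fu0 *.
    have xd : lt x' del by apply: delP; exists m.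
    rewrite kE (BE t s x') // uE //; left.
    exact: o1_trans lto _ _ _ xd (Bd _ Bs).
  have [t0 Bt0] : B !=set0.
    by apply: contrapT => /nonemptyPn B0; apply: nB; rewrite B0; exact: countable0.
  have hB s k : B s -> f (u s k) = f (u t0 k).
    move=> Bs; have [e|ne] := pselect (f (u t0 k) = 0); last exact: hE.
    by apply: contrapT => nf; apply: (nf); rewrite -(hE t0 s k) // => E; apply: nf; rewrite E.
  have [C fC] : exists C, forall k, `|f (u t0 k)| <= C.
    have /linear_bounded_continuous/linear_boundedP[M [_ MP]] := cf.
    exists (`|M| + 1) => k; apply: le_trans (MP (`|M| + 1) _ _) _.
      by rewrite ltr_pwDr // ler_norm.
    by rewrite ler_piMr // addr_ge0.
  have h0 := @power_series_zeros_eq0 R (f \o u t0) C (lam @` B) _ fC _.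
  have [xd|nxd] := pselect (lt x del); last first.
    by apply: contrapT => nf; apply: nxd; apply: delP; exists n.
  have xt0 : lt x t0 by exact: o1_trans lto _ _ _ xd (Bd _ Bt0).
  rewrite -(uE t0) //; last by left.
  apply: h0 => [fin|_ [t Bt <-]].
    apply: nB; apply: (@countable_image_inj _ _ _ lam).
      by move=> s t _ _; exact: lamI.
    exact: finite_set_countable.
  split => //; have <- : f \o u t = f \o u t0 by apply/funext => k; exact: hB.
  apply: form_series_vec => //; first exact: series_vec_cvg.
  by apply: fA; exact: BA.
have dense_ (Z : set X) : ~ countable (y @^-1` Z) -> linearly_dense Z.
  move=> nZ; apply: contrapT => /not_linearly_dense_form[f [cf fZ [x]]]; apply.
  exact: (key _ f cf nZ (fun t => fZ (y t))).
have nY : ~ countable (range y).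
  move=> cY; have [|c _ nc] := uncountable_fiber (f := y) nT cY.
    by move=> t _; exists t.
  have [|Q' cQ' dQ'] := @linearly_dense1_separable c.
    by apply: dense_; apply: sub_uncountable nc => t [].
  by apply: nK; apply: sub_countable cQ'; exact: Kmin.
have KY : (K #= range y)%card.
  apply/card_eqPle; split; first exact: Kle.
  apply: card_le_trans (card_image_le _ _) _.
  by rewrite (card_le_eql K0E); exact: subset_card_le.
exists (range y); split; first split.
- by exists Q => //; exact: card_eq_trans QK KY.
- by move=> D dD; rewrite -(card_le_eql KY); exact: Kmin.
move=> Z ZY ZYE; apply: dense_ => cZ; apply: nY.
rewrite -(eq_countable ZYE); apply: sub_countable (countable_image y cZ).
by apply: subset_card_le => x Zx; have [t _ yt] := ZY _ Zx; exists t => //=; rewrite yt.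
Qed.

End WLDOvercomplete.

(** * Unconditional sums *)

Section UnconditionalSums.
Variables (R : realType) (I : choiceType).
Local Open Scope fset_scope.
Local Open Scope ring_scope.

Definition fsum (V : nmodType) (u : I -> V) (F : {fset I}) : V := \sum_(i <- F) u i.

Lemma fsumD (V : nmodType) (u v : I -> V) F :
  fsum (fun i => u i + v i) F = fsum u F + fsum v F.
Proof. exact: big_split. Qed.

Lemma fsumUD (V : nmodType) (u : I -> V) F G :
  fsum u (F `|` G) = fsum u F + fsum u (G `\` F).
Proof.
rewrite /fsum (big_fsetID _ (mem F)); congr (_ + _); apply: eq_fbigl => i;
  rewrite !inE /=; by case: (i \in F); rewrite ?andbF ?andbT ?orbF.
Qed.

Definition usum (V : normedModType R) (u : I -> V) (x : V) :=
  forall e, 0 < e -> exists F0 : {fset I}, forall F, F0 `<=` F ->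
    `|x - fsum u F| < e.

Lemma usumP (V : normedModType R) (u : I -> V) (x : V) :
  summability.partial_sum u @ summability.totally --> x <-> usum u x.
Proof.
have E : summability.partial_sum u = fsum u.
  by apply/funext => F; rewrite /fsum big_seq_fsetE.
rewrite E; have FF := @summability.totally_filter I; split.
  move=> /cvgrPdist_lt cv e e0; have [F0 _ F0P] := cv e e0.
  by exists F0 => F F0F; apply: F0P.
move=> cv; apply/cvgrPdist_lt => e e0; have [F0 F0P] := cv e e0.
by exists F0 => // F /F0P.
Qed.

Section Normed.
Variable V : normedModType R.
Implicit Types (u v : I -> V) (x y : V).

Lemma usum_unique u x y : usum u x -> usum u y -> x = y.
Proof.
move=> ux uy; apply/eqP; rewrite -subr_eq0 -normr_le0.
apply/ler_addgt0Pr => e e0; rewrite add0r.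
have e2 : 0 < e / 2 by rewrite divr_gt0.
have [[F FP] [G GP]] := (ux _ e2, uy _ e2).
have := FP _ (fsubsetUl F G); have := GP _ (fsubsetUr F G).
set s := fsum u _ => ys xs; rewrite (_ : x - y = (x - s) - (y - s)); last first.
  by rewrite opprB addrA subrK.
by apply: le_trans (ler_normB _ _) _; lra.
Qed.

Lemma usumD u v x y : usum u x -> usum v y -> usum (fun i => u i + v i) (x + y).
Proof.
move=> ux vy e e0; have e2 : 0 < e / 2 by rewrite divr_gt0.
have [[F FP] [G GP]] := (ux _ e2, vy _ e2).
exists (F `|` G) => H FGH; rewrite fsumD opprD addrACA.
have := FP H (fsubset_trans (fsubsetUl _ _) FGH).
have := GP H (fsubset_trans (fsubsetUr _ _) FGH).
by move=> ? ?; apply: le_lt_trans (ler_normD _ _) _; lra.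
Qed.

Lemma usumZ a u x : usum u x -> usum (fun i => a *: u i) (a *: x).
Proof.
move=> ux e e0; have [|F FP] := ux (e / (1 + `|a|)).
  by rewrite divr_gt0 // ltr_wpDr.
exists F => G /FP; rewrite ltr_pdivlMr ?ltr_wpDr // => lt_e.
rewrite /fsum -scaler_sumr -scalerBr normrZ; apply: le_lt_trans lt_e.
by rewrite mulrC ler_wpM2l // lerDr.
Qed.

Lemma usum_single u j : (forall i, i != j -> u i = 0) -> usum u (u j).
Proof.
move=> u0 e e0; exists [fset j] => F; rewrite fsub1set => jF.
rewrite /fsum (big_fsetD1 j) //= big_seq big1 ?addr0 ?subrr ?normr0 // => i.
by rewrite !inE => /andP[/u0].
Qed.

Lemma usum_bounded u x : usum u x -> exists M, forall F, `|fsum u F| <= M.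
Proof.
move=> /(_ 1 ltr01)[F0 F0P].
exists (`|x| + 1 + \sum_(i <- F0) `|u i|) => F.
have := F0P _ (fsubsetUr F F0); rewrite fsumUD => lt1.
set s := fsum u F in lt1 *; set t := fsum u (F0 `\` F) in lt1.
have -> : s = x - (x - (s + t)) - t by rewrite opprB addrA addrAC subrr add0r addrK.
have tle : `|t| <= \sum_(i <- F0) `|u i|.
  apply: le_trans (ler_norm_sum _ _ _) _.
  rewrite [leRHS](big_fsetID _ (mem F)) /=.
  have -> : [fset i in F0 | i \notin F] = F0 `\` F.
    by apply/fsetP => i; rewrite !inE andbC.
  by rewrite lerDr sumr_ge0.
have := ler_normB (x - (x - (s + t))) t; have := ler_normB x (x - (s + t)).
lra.
Qed.

Lemma usum_norm_le u x C : usum u x -> (forall F, `|fsum u F| <= C) -> `|x| <= C.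
Proof.
move=> ux uC; apply/ler_addgt0Pr => e e0; have [F /(_ F (fsubset_refl _)) FP] := ux e e0.
have := uC F; have := ler_normD (x - fsum u F) (fsum u F); rewrite subrK; lra.
Qed.

End Normed.

Definition absum (v : I -> R) := exists C, forall F, fsum (fun i => `|v i|) F <= C.

Definition rsum (v : I -> R) : R := xget 0 [set s | usum (v : I -> R^o) s].

Lemma fsum_le_sub (v : I -> R) F G : (forall i, 0 <= v i) -> F `<=` G ->
  fsum v F <= fsum v G.
Proof.
move=> v0 FG; have -> : G = F `|` G by apply/esym/fsetUidPr.
by rewrite fsumUD lerDl sumr_ge0.
Qed.

Lemma usum_ge0 (v : I -> R) C : (forall i, 0 <= v i) ->
  (forall F, fsum v F <= C) -> exists s : R, usum (v : I -> R^o) s.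
Proof.
move=> v0 vC; pose S : set R := range (fsum v).
have Ssup : has_sup S.
  by split; [exists (fsum v fset0); exists fset0|exists C => _ [F _ <-]].
exists (sup S) => e e0; have [_ [F _ <-] Fe] := sup_adherent e0 Ssup.
exists F => G FG; have FGle := fsum_le_sub v0 FG.
have Gs : fsum v G <= sup S by apply: ub_le_sup; [case: Ssup|exists G].
by rewrite ger0_norm ?subr_ge0 //; rewrite /fsum in Fe FGle *; lra.
Qed.

Lemma rsumP (v : I -> R) : absum v -> usum (v : I -> R^o) (rsum v).
Proof.
move=> [C vC]; rewrite /rsum; case: xgetP => [s -> //|].
have le_abs i : v i <= `|v i| by exact: ler_norm.
have [|F|s1 us1] := @usum_ge0 (fun i => `|v i| + v i) (C + C).
- by move=> i; have := ler_norm (- v i); rewrite normrN; lra.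
- by rewrite fsumD lerD //; apply: le_trans (vC F); exact: ler_sum.
have [|s2 us2] := @usum_ge0 (fun i => `|v i|) C _ vC; first by move=> i.
move=> /(_ (s1 + (-1) *: (s2 : R^o))) [].
have := usumD us1 (usumZ (-1) us2).
set w := fun i => _; have -> // : w = v.
by apply/funext => i; rewrite /w scaleN1r addrAC subrr add0r.
Qed.

Lemma rsum_eq (v : I -> R) s : usum (v : I -> R^o) s -> rsum v = s.
Proof.
move=> vs; rewrite /rsum; case: xgetP => [t -> vt|/(_ s)//].
exact: usum_unique vt vs.
Qed.

Lemma absum_le (v w : I -> R) : (forall i, `|v i| <= `|w i|) -> absum w -> absum v.
Proof.
by move=> vw [C wC]; exists C => F; apply: le_trans (wC F); exact: ler_sum.
Qed.

Lemma absumZ a (v : I -> R) : absum v -> absum (fun i => a * v i).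
Proof.
move=> [C vC]; exists (`|a| * C) => F; rewrite /fsum.
under eq_bigr do rewrite normrM; rewrite -mulr_sumr ler_wpM2l //; exact: vC.
Qed.

Lemma rsumD (v w : I -> R) : absum v -> absum w ->
  rsum (fun i => v i + w i) = rsum v + rsum w.
Proof. by move=> av aw; apply/rsum_eq/(usumD (rsumP av) (rsumP aw)). Qed.

Lemma rsumZ a (v : I -> R) : absum v -> rsum (fun i => a * v i) = a * rsum v.
Proof. by move=> av; apply/rsum_eq/(usumZ a (rsumP av)). Qed.

Lemma fsum_le_rsum (v : I -> R) F : absum v -> (forall i, 0 <= v i) ->
  fsum v F <= rsum v.
Proof.
move=> av v0; apply/ler_addgt0Pr => e e0; have [F0 F0P] := rsumP av e0.
have := F0P _ (fsubsetUr F F0); have := fsum_le_sub v0 (fsubsetUl F F0).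
rewrite ltr_norml => le1 /andP[+ _]; rewrite /fsum in le1 *; lra.
Qed.

Lemma rsum_norm_le (v : I -> R) C : absum v ->
  (forall F, fsum (fun i => `|v i|) F <= C) -> `|rsum v| <= C.
Proof.
move=> av vC; apply: usum_norm_le (rsumP av) _ => F.
by apply: le_trans (vC F); exact: ler_norm_sum.
Qed.

Lemma rsum_le (v w : I -> R) : absum w -> (forall i, `|v i| <= w i) ->
  `|rsum v| <= rsum w.
Proof.
move=> aw vw; have w0 i : 0 <= w i by exact: le_trans (vw i).
apply: rsum_norm_le => [|F].
  by apply: absum_le aw => i; rewrite (ger0_norm (w0 i)).
by apply: le_trans (fsum_le_rsum F aw w0); exact: ler_sum.
Qed.

Lemma absum_support (v : I -> R) : absum v -> countable [set i | v i <> 0].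
Proof.
move=> [C vC]; pose L n := [set i | n.+1%:R^-1 < `|v i|].
apply: (@sub_countable _ _ _ (\bigcup_n L n)).
  apply: subset_card_le => i /eqP; rewrite -normr_gt0 => vi.
  by have [n] := ltr_add_invr vi; rewrite add0r => ni; exists n.
apply: bigcup_countable => [|n _]; first exact: countableP.
apply: finite_set_countable; apply: contrapT => infL.
pose k := (Num.truncn (`|C| * n.+1%:R)).+1.
have [B BL kB] := infinite_set_fset k infL.
have : k%:R * n.+1%:R^-1 <= C.
  apply: le_trans (vC B); rewrite /fsum.
  apply: le_trans (_ : \sum_(i <- B) n.+1%:R^-1 <= _).
    by rewrite big_const_seq count_predT iter_addr_0 -[leRHS]mulr_natl ler_wpM2r ?ler_nat.
  rewrite big_seq [leRHS]big_seq; apply: ler_sum => i iB.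
  by apply: ltW; apply: BL.
rewrite ler_pdivrMr // leNgt => /negP; apply.
apply: le_lt_trans (Num.Theory.truncnS_gt _); rewrite ler_wpM2r //; exact: ler_norm.
Qed.

End UnconditionalSums.

(** * Boundedness of basis expansions *)

Lemma series_recr (V : zmodType) (v : nat -> V) n :
  series v n.+1 = series v n + v n.
Proof. by rewrite /series /= big_nat_recr. Qed.

Lemma series0 (V : zmodType) (v : nat -> V) : series v 0%N = 0.
Proof. by rewrite /series /= big_geq. Qed.

Section Zabreiko.
Variables (R : realType) (X : completeNormedModType R).

Lemma norm_lim_le (V : normedModType R) (v : nat -> V) l c d N :
  v @ \oo --> l -> (forall n, (N <= n)%N -> `|v n - c| <= d) -> `|l - c| <= d.
Proof.
move=> vl vd; apply/ler_addgt0Pr => e e0.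
have /cvgrPdist_lt/(_ e e0)[M _ MP] := vl.
have := MP _ (leq_maxr N M); have := vd _ (leq_maxl N M).
set w := v _; have := ler_normD (l - w) (w - c).
by rewrite addrA subrK; lra.
Qed.

(* Zabreiko's lemma: by Baire some [closure {p <= n}] contains a ball, hence a
   ball at the origin; then successive approximation. *)
Lemma countably_subadditive_bounded (p : X -> R) :
  (forall x y, p (x + y) <= p x + p y) ->
  (forall a x, p (a *: x) = `|a| * p x) ->
  (forall (u : nat -> X) x C, series u @ \oo --> x ->
     (forall n, series (p \o u) n <= C) -> p x <= C) ->
  exists C, forall x, p x <= C * `|x|.
Proof.
move=> pD pZ psum.
have pN x : p (- x) = p x by rewrite -scaleN1r pZ normrN1 mul1r.
have p0 : p 0 = 0 by rewrite -(scale0r 0) pZ normr0 mul0r.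
have pge0 x : 0 <= p x by have := pD x (- x); rewrite subrr p0 pN; lra.
pose A (n : nat) := [set x | p x <= n%:R].
have [n [U [[x0 Ux0] oU UA]]] :
    exists n (U : set X), [/\ U !=set0, open U & U `<=` closure (A n)].
  apply: contrapT => nex.
  have BP (n : nat) : open (~` closure (A n)) /\ dense (~` closure (A n)).
    split; first by apply: closed_openC; exact: closed_closure.
    move=> U U0 oU; apply: contrapT => nU; apply: nex; exists n, U; split => //.
    by move=> y Uy; apply: contrapT => nAy; apply: nU; exists y.
  have [x [_ xA]] := Baire BP (ex_intro [set: X] 0 I) openT.
  apply: (xA (Num.truncn (p x)).+1 I); apply: subset_closure.
  by rewrite /A /= ltW // Num.Theory.truncnS_gt.
have /nbhs_ballP[r /= r0 rU] := open_nbhs_nbhs (conj oU Ux0).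
pose N : R := n%:R + n%:R.
have N0 : 0 <= N by rewrite addr_ge0.
have near0 x e : `|x| < r -> 0 < e -> exists2 z, p z <= N & `|x - z| < e.
  move=> xr e0; have e2 : 0 < e / 2 by rewrite divr_gt0.
  have clo y : `|y| < r -> exists2 z, p z <= n%:R & `|x0 + y - z| < e / 2.
    move=> yr; have /UA/(_ (ball (x0 + y) (e / 2))) : U (x0 + y).
      by apply: rU; rewrite -ball_normE /= opprD addrA subrr add0r normrN.
    case=> [|z [Az]]; first exact: nbhsx_ballx.
    by rewrite -ball_normE => ?; exists z.
  have [z1 pz1 z1e] := clo _ xr.
  have [|z2 pz2 z2e] := clo 0; first by rewrite normr0.
  exists (z1 - z2).
    by apply: le_trans (pD _ _) _; rewrite pN /N; lra.
  have -> : x - (z1 - z2) = (x0 + x - z1) - (x0 + 0 - z2).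
    by rewrite addr0 !opprB [x0 + x]addrC -!addrA; congr (_ + _); rewrite [RHS]addrC
      -!addrA addNr addr0 addrC.
  by apply: le_lt_trans (ler_normB _ _) _; lra.
have step k x : exists z, `|x| < r / 2 ^+ k ->
    p z <= N / 2 ^+ k /\ `|x - z| < r / 2 ^+ k.+1.
  have [xr|] := pselect (`|x| < r / 2 ^+ k); last by exists 0.
  have k0 : 0 < 2 ^+ k :> R by rewrite exprn_gt0.
  have [||z pz zr] := near0 (2 ^+ k *: x) (r / 2).
  - by rewrite normrZ gtr0_norm // mulrC -ltr_pdivlMr.
  - by rewrite divr_gt0.
  exists ((2 ^+ k)^-1 *: z) => _; split.
    by rewrite pZ gtr0_norm ?invr_gt0 // mulrC ler_wpM2r // invr_ge0 ltW.
  rewrite -(@ltr_pM2l _ (2 ^+ k)) // -{1}(gtr0_norm k0) -normrZ scalerBr.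
  rewrite scalerA divff ?gt_eqF // scale1r; apply: lt_le_trans zr _.
  rewrite exprS le_eqVlt; apply/orP; left; apply/eqP; field.
  by rewrite gt_eqF.
have [z zP] := choice (fun kx : nat * X => step kx.1 kx.2).
pose xs x := fix xs k := if k is k'.+1 then xs k' - z (k', xs k') else x.
have xsP x k : `|x| < r -> `|xs x k| < r / 2 ^+ k.
  move=> xr; elim: k => [|k IH]; first by rewrite expr0 divr1.
  by have [_] := zP (k, xs x k) IH.
have small x : `|x| < r -> p x <= 2 * N.
  move=> xr; apply: (psum (fun k => z (k, xs x k))) => [|m].
    have -> : series (fun k => z (k, xs x k)) = (fun k => x - xs x k).
      apply/funext; elim=> [|k IH]; first by rewrite series0 subrr.
      by rewrite series_recr IH /= opprB addrA addrAC.
    apply/cvgrPdist_lt => e e0.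
    have [M _ MP] : \forall k \near \oo, `|r * 2^-1 ^+ k| < e.
      apply: cvgr0_norm_lt => //.
      suff : (fun k => r * 2^-1 ^+ k) @ \oo --> r * 0 by rewrite mulr0.
      by apply: cvgMl_tmp; apply: cvg_expr; rewrite gtr0_norm //; lra.
    exists M => // k Mk; rewrite opprB addrC subrK.
    apply: lt_trans (xsP x k xr) _; apply: le_lt_trans (MP k Mk).
    by rewrite exprVn ler_norm.
  have : series (p \o (fun k => z (k, xs x k))) m <= 2 * N * (1 - 2^-1 ^+ m).
    elim: m => [|m IH]; first by rewrite series0 expr0 subrr mulr0.
    rewrite series_recr.
    have [+ _] := zP (m, xs x m) (xsP x m xr).
    by rewrite exprS -exprVn => /= pz; apply: le_trans (lerD IH pz) _; lra.
  have : 0 <= N * 2^-1 ^+ m by rewrite mulr_ge0 // exprn_ge0 // invr_ge0.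
  by lra.
exists (2 * N * (2 / r)) => x; have [->|xn0] := eqVneq x 0.
  by rewrite p0 normr0 mulr0.
have nx : 0 < `|x| by rewrite normr_gt0.
have c0 : 0 < r / (2 * `|x|) by rewrite divr_gt0 // mulr_gt0.
have : p ((r / (2 * `|x|)) *: x) <= 2 * N.
  apply: small; rewrite normrZ gtr0_norm // invfM mulrA mulfVK ?gt_eqF //.
  lra.
rewrite pZ gtr0_norm // -ler_pdivlMl // => /le_trans; apply.
by rewrite invf_div le_eqVlt; apply/orP; left; apply/eqP; ring.
Qed.

End Zabreiko.

Section Basis.
Variables (R : realType) (X : completeNormedModType R).
Variables (I : choiceType) (e : I -> X).
Hypothesis be : unconditional_basis e.
Local Open Scope fset_scope.
Local Open Scope ring_scope.

Let coord_ex x : exists a : I -> R, usum (fun i => a i *: e i) x /\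
  forall b, usum (fun i => b i *: e i) x -> b = a.
Proof.
have [a [/usumP xa ua]] := be x; exists a; split => // b /usumP xb.
by rewrite (ua b).
Qed.

Definition coord x : I -> R := sval (cid (coord_ex x)).

Lemma coordP x : usum (fun i => coord x i *: e i) x.
Proof. by have [] := svalP (cid (coord_ex x)). Qed.

Lemma coord_eq x b : usum (fun i => b i *: e i) x -> coord x = b.
Proof. by have [_ u] := svalP (cid (coord_ex x)) => /u ->. Qed.

Lemma coordD x y i : coord (x + y) i = coord x i + coord y i.
Proof.
have /coord_eq -> // : usum (fun i => (coord x i + coord y i) *: e i) (x + y).
have := usumD (coordP x) (coordP y); congr usum.
by apply/funext => j; rewrite scalerDl.
Qed.

Lemma coordZ a x i : coord (a *: x) i = a * coord x i.
Proof.
have /coord_eq -> // : usum (fun i => (a * coord x i) *: e i) (a *: x).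
have := usumZ a (coordP x); congr usum.
by apply/funext => j; rewrite scalerA.
Qed.

Lemma coord_basis i j : coord (e i) j = (j == i)%:R.
Proof.
have /coord_eq -> // : usum (fun j => (j == i)%:R *: e j) (e i).
have := @usum_single R I X (fun j => (j == i)%:R *: e j) i.
rewrite eqxx scale1r; apply => k /negbTE ->; exact: scale0r.
Qed.

Lemma basis_neq0 i : e i != 0.
Proof.
apply/eqP => ei0; have := coord_basis i i; rewrite ei0 eqxx.
have := coordZ 0 0 i; rewrite scaler0 mul0r => -> /esym/eqP.
by rewrite oner_eq0.
Qed.

Let proj x F := fsum (fun i => coord x i *: e i) F.

Let projD x y F : proj (x + y) F = proj x F + proj y F.
Proof. by rewrite -fsumD; apply: eq_bigr => i _; rewrite coordD scalerDl. Qed.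

Let projZ a x F : proj (a *: x) F = a *: proj x F.
Proof. by rewrite /proj /fsum scaler_sumr; apply: eq_bigr => i _; rewrite coordZ scalerA. Qed.

Let p x : R := sup (range (fun F => `|proj x F|)).

Let p_sup x : has_sup (range (fun F => `|proj x F|)).
Proof.
split; first by exists `|proj x fset0|; exists fset0.
have [M MP] := usum_bounded (coordP x).
by exists M => _ [F _ <-]; exact: MP.
Qed.

Let proj_le x F : `|proj x F| <= p x.
Proof. by apply: ub_le_sup; [have [] := p_sup x|exists F]. Qed.

Let p_le x C : (forall F, `|proj x F| <= C) -> p x <= C.
Proof.
move=> xC; apply: ge_sup; first by have [] := p_sup x.
by move=> _ [F _ <-]; exact: xC.
Qed.

Let norm_le_p x : `|x| <= p x.
Proof. exact: usum_norm_le (coordP x) (proj_le x). Qed.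

Let pD x y : p (x + y) <= p x + p y.
Proof.
apply: p_le => F; rewrite projD; apply: le_trans (ler_normD _ _) _.
by rewrite lerD.
Qed.

Let pZ a x : p (a *: x) = `|a| * p x.
Proof.
have half b z : p (b *: z) <= `|b| * p z.
  by apply: p_le => F; rewrite projZ normrZ ler_wpM2l.
apply/eqP; rewrite eq_le half /=; have [->|a0] := eqVneq a 0.
  by rewrite normr0 mul0r (le_trans _ (norm_le_p _)).
have := half a^-1 (a *: x); rewrite scalerA mulVf // scale1r normfV.
by rewrite ler_pdivlMl ?normr_gt0.
Qed.

Let p_series (u : nat -> X) x C : series u @ \oo --> x ->
  (forall n, series (p \o u) n <= C) -> p x <= C.
Proof.
move=> ux uC.
have p0 z : 0 <= p z by exact: le_trans (norm_le_p z).
have coord0 i : coord 0 i = 0 by rewrite -(scale0r 0) coordZ mul0r.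
have proj0 F : proj 0 F = 0.
  by rewrite /proj /fsum big1 // => i _; rewrite coord0 scale0r.
pose T := series (p \o u).
have TS n : T n.+1 = T n + p (u n) by exact: series_recr.
have Tmono : {homo T : n m / (n <= m)%N >-> n <= m}.
  by apply/nondecreasing_seqP => n; rewrite TS lerDl.
have Tcvg : cvg (T @ \oo).
  by apply: nondecreasing_is_cvgn => //; exists C => _ [n _ <-].
pose L := lim (T @ \oo).
have TL n : T n <= L by exact: nondecreasing_cvgn_le.
have pT n m : (n <= m)%N -> p (series u m - series u n) <= T m - T n.
  move=> /subnK <-; elim: (m - n)%N => [|k IH].
    by rewrite add0n !subrr -(scale0r 0) pZ normr0 mul0r.
  rewrite addSn series_recr TS addrAC (le_trans (pD _ _)) // [leRHS]addrAC.
  by rewrite lerD2r.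
have pL n m : (n <= m)%N -> p (series u m - series u n) <= L - T n.
  by move=> nm; apply: le_trans (pT _ _ nm) _; rewrite lerD2r.
have coordS i n : coord (series u n) i = series (fun k => coord (u k) i) n.
  elim: n => [|n IH]; first by rewrite series0 coord0 series0.
  by rewrite series_recr coordD IH series_recr.
have cvgi i : cvg ((fun n => coord (series u n) i) @ \oo).
  have -> : (fun n => coord (series u n) i) = series (fun k => coord (u k) i).
    by apply/funext => n; exact: coordS.
  apply: (@normed_cvg R R^o); have ei : 0 < `|e i| by rewrite normr_gt0 basis_neq0.
  apply: (@series_le_cvg _ _ (fun k => `|e i|^-1 * p (u k))) => [k|k|k|].
  - exact: normr_ge0.
  - by rewrite mulr_ge0 // invr_ge0.
  - rewrite ler_pdivlMl // mulrC -normrZ.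
    by have := proj_le (u k) [fset i]; rewrite /proj /fsum big_seq_fset1.
  have -> : series (fun k => `|e i|^-1 * p (u k)) = (fun n => `|e i|^-1 * T n).
    by apply/funext => n; rewrite /T /series /= mulr_sumr.
  by apply: is_cvgMl_tmp.
pose b i : R := lim ((fun n => coord (series u n) i) @ \oo).
pose projb F := fsum (fun i => b i *: e i) F.
have proj_cvg F : (fun n => proj (series u n) F) @ \oo --> projb F.
  rewrite /proj /projb /fsum.
  apply: cvg_big => [|i _]; first exact: add_continuous.
  apply: cvgZr_tmp; exact: cvgi.
have xb : coord x = b.
  apply: coord_eq => d d0; have d4 : 0 < d / 4 by rewrite divr_gt0.
  have /cvgrPdist_lt/(_ _ d4)[N _ /(_ N (leqnn _)) /= TN] := Tcvg.
  have LT : L - T N <= d / 4 by apply: le_trans (ler_norm _) (ltW TN).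
  have [F0 F0P] := coordP (series u N) d4.
  exists F0 => F F0F; have sF := F0P F F0F.
  have xN : `|x - series u N| <= d / 4.
    apply: (norm_lim_le (N := N) ux) => n Nn.
    by apply: le_trans (norm_le_p _) (le_trans (pL _ _ Nn) LT).
  have bN : `|projb F - proj (series u N) F| <= d / 4.
    apply: (norm_lim_le (N := N) (proj_cvg F)) => n Nn.
    have -> : proj (series u n) F - proj (series u N) F =
        proj (series u n - series u N) F.
      by rewrite projD -[- series u N]scaleN1r projZ scaleN1r.
    by apply: le_trans (proj_le _ _) (le_trans (pL _ _ Nn) LT).
  rewrite -/(projb F).
  have -> : x - projb F = (x - series u N) + (series u N - proj (series u N) F)
      - (projb F - proj (series u N) F).
    by rewrite addrA subrK opprB addrA subrK.
  apply: le_lt_trans (ler_normB _ _) _.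
  have := ler_normD (x - series u N) (series u N - proj (series u N) F).
  rewrite /proj in bN *; lra.
apply: p_le => F; rewrite -[proj x F]subr0.
have -> : proj x F = projb F by rewrite /proj xb.
apply: (norm_lim_le (N := 0) (proj_cvg F)) => n _; rewrite subr0.
apply: le_trans (proj_le _ _) _; have := pT 0%N n (leq0n _).
by rewrite series0 subr0 /T series0 subr0 => /le_trans; apply.
Qed.

Lemma coord_form_absum (f : {linear X -> R^o}) : continuous f ->
  exists C, forall x F, fsum (fun i => `|coord x i * f (e i)|) F <= C * `|x|.
Proof.
move=> cf; have [C pC] := countably_subadditive_bounded pD pZ p_series.
have /linear_bounded_continuous/linear_boundedP[M0 [_ /(_ (`|M0| + 1)) MP]] := cf.
set M := `|M0| + 1 in MP; have {}MP := MP (ltr_pwDr ltr01 (ler_norm _)).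
have M_ge0 : 0 <= M by rewrite addr_ge0.
exists (2 * (M * `|C|)) => x F.
have sgn G : `|fsum (fun i => coord x i * f (e i)) G| <= M * `|C| * `|x|.
  have -> : fsum (fun i => coord x i * f (e i)) G = f (proj x G).
    by rewrite /proj /fsum linear_sum; apply: eq_bigr => i _; rewrite linearZ.
  apply: le_trans (MP _) _; rewrite -mulrA ler_wpM2l //.
  apply: le_trans (proj_le _ _) (le_trans (pC _) _).
  by rewrite ler_wpM2r // ler_norm.
rewrite /fsum (big_fsetID _ (fun i => 0 <= coord x i * f (e i))) /=.
rewrite -mulrA mulr_natl mulr2n; apply: lerD.
  apply: le_trans (sgn _); apply: le_trans (ler_norm _).
  rewrite big_seq [leRHS]big_seq; apply: ler_sum => i.
  by rewrite !inE /= => /andP[_ /ger0_norm ->].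
apply: le_trans (sgn _); rewrite -normrN; apply: le_trans (ler_norm _).
rewrite -sumrN big_seq [leRHS]big_seq; apply: ler_sum => i.
by rewrite !inE /= -ltNge => /andP[_ /ltr0_norm ->].
Qed.

End Basis.

(** * Weights annihilating uncountably many vectors *)

Section NoOvercompleteInL1.
Variables (R : realType) (X : completeNormedModType R) (I : choiceType).
Variables (theta : X -> I -> R) (e : I -> X) (C : R) (Y : set X).
Hypothesis theta_lin : forall a x y i,
  theta (a *: x + y) i = a * theta x i + theta y i.
Hypothesis theta_le : forall x F, fsum (fun i => `|theta x i|) F <= C * `|x|.
Hypothesis theta_diag : forall i j, i != j -> theta (e j) i = 0.
Hypothesis theta_unct : ~ countable [set i | theta (e i) i <> 0].
Hypothesis Y_unct : ~ countable Y.
Hypothesis Y_zeros : forall f : {linear X -> R^o}, continuous f ->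
  (exists x, f x <> 0) -> countable [set y | Y y /\ f y = 0].

Let pairing (g : I -> R) x := rsum (fun i => g i * theta x i).

Let norm_on (B : set I) y := rsum (fun i => if i \in B then `|theta y i| else 0).

Let absum_theta y : absum (theta y).
Proof. by exists (C * `|y|) => F; exact: theta_le. Qed.

Let absum_on (B : set I) y : absum (fun i => if i \in B then `|theta y i| else 0).
Proof.
apply: absum_le (absum_theta y) => i.
by case: ifP; rewrite ?normr_id // normr0.
Qed.

Let absum_pairing (g : I -> R) y : (forall i, `|g i| <= 1) ->
  absum (fun i => g i * theta y i).
Proof.
by move=> g1; apply: absum_le (absum_theta y) => i; rewrite normrM ler_piMl.
Qed.

Let pairing_form (g : I -> R) : (forall i, `|g i| <= 1) ->
  exists2 f : {linear X -> R^o}, continuous f & forall x, f x = pairing g x.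
Proof.
move=> g1; have fl : linear (pairing g : X -> R^o).
  move=> a x y; suff : pairing g (a *: x + y) = a * pairing g x + pairing g y :> R.
    by [].
  have [ax ay] := (absum_pairing x g1, absum_pairing y g1).
  rewrite /pairing -(rsumZ a ax) -(rsumD (absumZ a ax) ay).
  by congr rsum; apply/funext => i; rewrite theta_lin; ring.
pose f : {linear X -> R^o} := HB.pack (pairing g : X -> R^o)
  (GRing.isLinear.Build R X R^o _ (pairing g) fl).
exists f => //; apply: (@continuous_form _ _ _ C) => x.
apply: rsum_norm_le => [|F]; first exact: absum_pairing.
apply: le_trans (theta_le x F); apply: ler_sum => i _.
by rewrite normrM ler_piMl.
Qed.

Let pairing_single (g : I -> R) x j : (forall i, i != j -> g i * theta x i = 0) ->
  pairing g x = g j * theta x j.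
Proof. by move=> h; apply: rsum_eq; exact: usum_single. Qed.

Let norm_on_ge0 B y : 0 <= norm_on B y.
Proof.
have := @fsum_le_rsum R I _ fset0 (absum_on B y); rewrite /fsum big_nil; apply.
by move=> i; case: ifP.
Qed.

Let norm_on_sub B B' y : B `<=` B' -> norm_on B y <= norm_on B' y.
Proof.
move=> BB'; rewrite -(ger0_norm (norm_on_ge0 B y)); apply: rsum_le; first exact: absum_on.
move=> i; case: ifPn => [/set_mem/BB'/mem_set ->|_]; first by rewrite normr_id.
by rewrite normr0; case: ifP.
Qed.

Let norm_on_ge B y j : B j -> `|theta y j| <= norm_on B y.
Proof.
move=> Bj; have := @fsum_le_rsum R I _ [fset j]%fset (absum_on B y).
rewrite /fsum big_seq_fset1 mem_set //; apply => i.
by case: ifP.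
Qed.

Let norm_on_small (A : set I) y eps : 0 < eps ->
  exists F : {fset I}, [set` F] `<=` A /\ norm_on (A `\` [set` F]) y <= eps.
Proof.
move=> eps0; pose v i := if i \in A then `|theta y i| else 0.
have v0 i : 0 <= v i by rewrite /v; case: ifP.
have av : absum v by exact: absum_on.
have [F0 F0P] := rsumP av eps0.
exists [fset i in F0 | i \in A]%fset; split.
  by move=> i /=; rewrite !inE /= => /andP[_ /set_mem].
set B := _ `\` _.
rewrite -(ger0_norm (norm_on_ge0 B y)); apply: rsum_norm_le => [|G]; first exact: absum_on.
set w := fun i => _.
have w0 i : 0 <= w i by rewrite /w.
have wv i : w i <= v i.
  rewrite /w /v /B; case: ifPn => [/set_mem[/mem_set -> _]|_]; first by rewrite normr_id.
  by rewrite normr0; case: ifP.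
have wF0 i : i \in F0 -> w i = 0.
  move=> iF0; rewrite /w /B; case: ifPn => [/set_mem[/mem_set iA []]|]; last by rewrite normr0.
  by rewrite /= !inE iF0.
apply: le_trans (fsum_le_sub w0 (fsubsetUr F0 G)) _; rewrite fsumUD.
have -> : fsum w F0 = 0 by rewrite /fsum big_seq big1.
rewrite add0r; apply: le_trans (_ : fsum v (G `\` F0)%fset <= _).
  exact: ler_sum.
have := F0P F0 (fsubset_refl _).
have := fsum_le_rsum (F0 `|` G)%fset av v0; rewrite fsumUD.
by rewrite ltr_norml => le1 /andP[_]; rewrite /fsum in le1 *; lra.
Qed.

Let good (F : {fset I}) (A : set I) : set X := [set y | [/\ Y y,
  0 < norm_on (~` A) y & norm_on (A `\` [set` F]) y <= norm_on (~` A) y]].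

Let good_sub F A A' : A `<=` A' -> good F A' `<=` good F A.
Proof.
move=> AA' y [Yy y0 yle].
have le1 : norm_on (~` A') y <= norm_on (~` A) y by apply: norm_on_sub; exact: subsetC.
split => //; first exact: lt_le_trans le1.
apply: le_trans le1; apply: le_trans yle.
by apply: norm_on_sub; exact: setSD.
Qed.

Let countable_fsets (A : set I) : countable A ->
  countable [set F : {fset I} | [set` F] `<=` A].
Proof.
move=> cA; apply: (@countable_image_inj _ _ _ (fun F : {fset I} => [set` F])).
  by move=> F G _ _ /(congr1 (@fset_set I)); rewrite !set_fsetK.
apply: sub_countable (countable_finite_subset cA); apply: subset_card_le.
by move=> _ [F FA <-]; split => //; exact: finite_fset.
Qed.

Let coordinate_zeros j : theta (e j) j <> 0 -> countable [set y | Y y /\ theta y j = 0].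
Proof.
move=> ej; pose g i : R := (i == j)%:R.
have g1 i : `|g i| <= 1 by rewrite /g; case: eqP; rewrite ?normr1 ?normr0.
have [f cf fE] := pairing_form g1.
have fj x : f x = theta x j.
  rewrite fE (pairing_single (j := j)) /g ?eqxx ?mul1r // => i /negbTE ->.
  by rewrite mul0r.
rewrite (_ : [set y | _] = [set y | Y y /\ f y = 0]).
  by apply: Y_zeros => //; exists (e j); rewrite fj.
by apply/seteqP; split => y /=; rewrite fj.
Qed.

Let good_exists : exists F, forall A, countable A -> ~ countable (good F A).
Proof.
apply: contrapT => nF.
have Aex (F : {fset I}) : exists A, countable A /\ countable (good F A).
  apply: contrapT => nA; apply: nF; exists F => A cA cG.
  by apply: nA; exists A.
have [Af AfP] := choice Aex.
pose A_ := fix A_ n : set I := if n is n'.+1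
  then A_ n' `|` \bigcup_(F in [set F : {fset I} | [set` F] `<=` A_ n']) Af F
  else set0.
have cA_ n : countable (A_ n).
  elim: n => [|n IH]; first exact: countable0.
  apply: countableU => //; apply: bigcup_countable => [|F _]; first exact: countable_fsets.
  by have [] := AfP F.
have A_mono m n : (m <= n)%N -> A_ m `<=` A_ n.
  move=> /subnK <-; elim: (n - m)%N => [|k IH] // x /IH; by left.
pose A := \bigcup_n A_ n.
have cA : countable A by apply: bigcup_countable => // ; exact: countableP.
have AfA F : [set` F] `<=` A -> Af F `<=` A.
  move=> FA; have nex i : exists n, i \in F -> A_ n i.
    have [iF|] := boolP (i \in F); last by exists 0%N.
    by have [k _ ki] := FA i iF; exists k.
  have [n nP] := choice nex.
  have FN : [set` F] `<=` A_ (\max_(i <- F) n i)%N.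
    by move=> i iF; apply: A_mono (nP i iF); exact: leq_bigmax_seq.
  by move=> x Afx; exists (\max_(i <- F) n i).+1 => //; right; exists F.
have [j [ej nAj]] : exists j, theta (e j) j <> 0 /\ ~ A j.
  apply: contrapT => nj; apply: theta_unct; apply: sub_countable cA.
  by apply: subset_card_le => j ej; apply: contrapT => nAj; apply: nj; exists j.
apply: Y_unct; apply: (@sub_countable _ _ _ ([set y | Y y /\ theta y j = 0] `|`
    \bigcup_(F in [set F : {fset I} | [set` F] `<=` A]) good F A)).
  apply: subset_card_le => y Yy; have [yj|/eqP yj] := pselect (theta y j = 0); first by left.
  have y0 : 0 < norm_on (~` A) y.
    by apply: lt_le_trans (@norm_on_ge (~` A) y j nAj); rewrite normr_gt0.
  by have [F [FA Fle]] := norm_on_small A y y0; right; exists F.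
apply: countableU; first exact: coordinate_zeros.
apply: bigcup_countable => [|F FA]; first exact: countable_fsets.
apply: sub_countable (subset_card_le (good_sub (F := F) (AfA F FA))) _.
by have [] := AfP F.
Qed.

Let support y := [set i | theta y i <> 0].

Lemma overcomplete_l1_false : False.
Proof.
have [F goodF] := good_exists.
have [i0 [ei0 i0F]] : exists i, theta (e i) i <> 0 /\ i \notin F.
  apply: contrapT => nj; apply: theta_unct; apply: sub_countable (countable_fset F).
  apply: subset_card_le => j ej /=; apply: contrapT => nFj; apply: nj; exists j.
  by split => //; apply/negP.
pose dom (Z : set X) : set I := [set` F] `|` [set i0] `|` \bigcup_(z in Z) support z.
pose ok (s : set X * (I -> R)) := [/\ s.1 `<=` Y, (forall i, `|s.2 i| <= 1),
  (forall i, i \in F -> s.2 i = 0), s.2 i0 = 1 & forall z, s.1 z -> pairing s.2 z = 0].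
pose T := {s | ok s}.
pose ext (s t : T) := `[< (sval s).1 `<=` (sval t).1 /\
  forall i, dom (sval s).1 i -> (sval t).2 i = (sval s).2 i >].
have dom_sub (Z Z' : set X) : Z `<=` Z' -> dom Z `<=` dom Z'.
  by move=> ZZ' i [?|[z Zz zi]]; [left|right; exists z => //; exact: ZZ'].
have pairing_dom (Z : set X) g g' z : Z z -> (forall i, dom Z i -> g' i = g i) ->
    pairing g' z = pairing g z.
  move=> Zz gg'; congr rsum; apply/funext => i.
  have [->|/eqP zi] := eqVneq (theta z i) 0; first by rewrite !mulr0.
  by rewrite gg' //; right; exists z.
have ok0 : ok (set0, fun i => (i == i0)%:R).
  split => //= [i|i iF|]; rewrite ?eqxx //.
    by case: (i =P i0); rewrite ?normr1 ?normr0.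
  by case: eqP iF => // -> iF; rewrite iF in i0F.
have [[[Z g] [/= ZY g1 gF gi0 gZ]] maxZ] : exists t, premaximal (fun s t => ext s t) t.
  apply: (ZL_preorder (exist ok _ ok0)).
  - by move=> t; apply/asboolP; split.
  - move=> r s t /asboolP[rs1 rs2] /asboolP[st1 st2]; apply/asboolP; split.
      exact: subset_trans st1.
    by move=> i di; rewrite st2 ?rs2 //; exact: dom_sub di.
  move=> Ch totCh.
  have [[s0 Cs0]|nCh] := pselect (Ch !=set0); last first.
    by exists (exist ok _ ok0) => s Cs; exfalso; apply: nCh; exists s.
  pose Zs := \bigcup_(s in Ch) (sval s).1.
  have gex i : exists a : R,
      (forall s, Ch s -> dom (sval s).1 i -> a = (sval s).2 i) /\ `|a| <= 1.
    have [[s [Cs si]]|ns] := pselect (exists s, Ch s /\ dom (sval s).1 i); last first.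
      exists 0; split; last by rewrite normr0.
      by move=> s Cs si; exfalso; apply: ns; exists s.
    exists ((sval s).2 i); split; last by have [_ + _ _ _] := svalP s; exact.
    move=> t Ct ti.
    by have [/asboolP[_ /(_ i si) ->]|/asboolP[_ /(_ i ti) ->]] := totCh _ _ Cs Ct.
  have [g gP] := choice gex.
  have okg : ok (Zs, g).
    split => /=.
    + by move=> z [s Cs sz]; have [+ _ _ _ _] := svalP s; apply.
    + by move=> i; have [] := gP i.
    + move=> i iF; have [h _] := gP i; rewrite (h s0 Cs0); last by do 2!left.
      by have [_ _ + _ _] := svalP s0; apply.
    + have [h _] := gP i0; rewrite (h s0 Cs0); last by (left; right).
      by have [_ _ _ + _] := svalP s0.
    + move=> z [s Cs sz].
      rewrite (pairing_dom (sval s).1 (sval s).2) // => [|i si].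
        by have [_ _ _ _ +] := svalP s; apply.
      by have [h _] := gP i; exact: h.
  exists (exist ok _ okg) => s Cs; apply/asboolP; split => /=.
    by move=> z sz; exists s.
  by move=> i si; have [h _] := gP i; exact: h.
have nZ : ~ countable Z.
  move=> cZ; pose A := dom Z.
  have cA : countable A.
    apply: countableU; first by apply: countableU; [exact: countable_fset|exact: countable1].
    by apply: bigcup_countable => // z _; exact: absum_support.
  have [y [[Yy t0 yt] nZy]] : exists y, good F A y /\ ~ Z y.
    apply: contrapT => ny; apply: (goodF A cA); apply: sub_countable cZ.
    by apply: subset_card_le => y Gy; apply: contrapT => nZy; apply: ny; exists y.
  set t := norm_on (~` A) y in t0 yt.
  pose c := rsum (fun i => if i \in A then g i * theta y i else 0).
  have act : absum (fun i => if i \in A then g i * theta y i else 0).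
    apply: absum_le (absum_theta y) => i; case: ifP => _; last by rewrite normr0.
    by rewrite normrM ler_piMl.
  have ct : `|c| <= t.
    apply: le_trans yt; apply: rsum_le; first exact: absum_on.
    move=> i; case: ifPn => [iA|_]; last by rewrite normr0; case: ifP.
    case: ifPn => [_|niA]; first by rewrite normrM ler_piMl.
    rewrite gF ?mul0r ?normr0 //; apply: contrapT => /negP iF; case/negP: niA.
    by apply/mem_set; split; [exact: set_mem|exact/negP].
  pose g' i := if i \in A then g i else - (c / t) * Num.sg (theta y i).
  have g'A i : A i -> g' i = g i by move=> Ai; rewrite /g' mem_set.
  have ok' : ok (Z `|` [set y], g').
    split => /=.
    - by move=> z [/ZY|->].
    - move=> i; rewrite /g'; case: ifP => // _.
      rewrite normrM normrN normrM normfV (gtr0_norm t0) normr_sg.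
      case: (_ != _); rewrite ?mulr0 // mulr1 ler_pdivrMr // mul1r.
      exact: ct.
    - by move=> i iF; rewrite g'A ?gF //; left; left.
    - by rewrite g'A //; left; right.
    - move=> z [Zz|->]; first by rewrite (pairing_dom Z g) ?gZ.
      rewrite /pairing (_ : (fun i => _) = (fun i =>
        (if i \in A then g i * theta y i else 0) + (- (c / t)) *
        (if i \in ~` A then `|theta y i| else 0))).
        rewrite rsumD //; last by apply: absumZ; exact: absum_on.
        rewrite rsumZ; last exact: absum_on.
        by rewrite -/c -/(norm_on _ _) -/t mulNr mulfVK ?gt_eqF // subrr.
      apply/funext => i; rewrite /g' in_setC; case: (i \in A) => /=.
        by rewrite mulr0 addr0.
      by rewrite add0r -mulrA -normrEsg.
  have /asboolP[/= + _] : ext (exist ok _ ok') (exist ok (Z, g) (And5 ZY g1 gF gi0 gZ)).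
    apply: maxZ; apply/asboolP; split => /=; first by move=> z; left.
    exact: g'A.
  by move=> /(_ y) h; apply/nZy/h; right.
have [f cf fE] := pairing_form g1.
apply: nZ; apply: sub_countable (Y_zeros cf _); last first.
  exists (e i0); rewrite fE (pairing_single (j := i0)); first by rewrite gi0 mul1r.
  by move=> i ii0; rewrite theta_diag ?mulr0.
by apply: subset_card_le => z Zz; split; [exact: (ZY _ Zz)|rewrite fE; exact: (gZ _ Zz)].
Qed.

End NoOvercompleteInL1.

Theorem corollary31 (R : realType) (X : completeNormedModType R)
    (hinf : infinite_dimensional X) (hdens : density_omega1 X)
    (hbasis : exists (I : choiceType) (e : I -> X), unconditional_basis e) :
  (exists Y : set X, overcomplete Y) <-> WLD X.
Proof.
split; last exact: wld_overcomplete.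
move=> [Y [dY oY]]; have [I [e be]] := hbasis.
exists (range e).
  move=> O [x Ox] oO.
  have /nbhs_ballP[r /= r0 rO] := open_nbhs_nbhs (conj oO Ox).
  have [F /(_ F (fsubset_refl _)) xF] := coordP be x r0.
  exists (fsum (fun i => coord be x i *: e i) F); split.
    by apply: rO; rewrite -ball_normE.
  apply: big_ind => [|u v|i _]; [exact: linear_span0|exact: linear_spanD|].
  by apply/linear_spanZ/linear_span_sub; exists i.
move=> f cf; apply: contrapT => nct.
have [K [[Q dQ QK] Kmin] [nK Kle]] := hdens.
have KY : (K #<= Y)%card.
  have [[D dD DY] _] := dY.
  by rewrite -(card_le_eqr DY); exact: Kmin.
have YK : (Y #<= K)%card by have [_ h] := dY; rewrite -(card_le_eqr QK); exact: h.
have nY : ~ countable Y by move=> cY; apply: nK; exact: sub_countable cY.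
have [C CP] := coord_form_absum be cf.
apply: (@overcomplete_l1_false R X I (fun x i => coord be x i * f (e i)) e C Y) => //.
- by move=> a x y i; rewrite coordD coordZ mulrDl mulrA.
- by move=> i j ij; rewrite coord_basis (negbTE ij) mul0r.
- apply: contra_not nct => ct.
  apply: sub_countable (countable_image e ct); apply: subset_card_le.
  by move=> _ [[i _ <-] fi]; exists i => //=; rewrite coord_basis eqxx mul1r.
move=> h ch [x hx]; apply: contrapT => nh; apply: hx.
apply: (@form_eq0_dense _ _ [set y | Y y /\ h y = 0]) ch _ x; last by move=> z [].
apply: oY; first by move=> z [].
apply/card_eqPle; split; first by apply: subset_card_le => z [].
by apply: card_le_trans YK _; exact: Kle.
Qed.
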